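(* Let $a>0$ and let $V:\mathbf{R}\to\mathbf{C}$ satisfy $e^{2a|x|}V(x)\in L^2(\mathbf{R})$. Let $\nu_1(x,\lambda),\nu_2(x,\lambda)$ be the solutions of $$\left(\frac{d^2}{dx^2}+\lambda-V(x)\right)\mu=0$$ with $\nu_1(0,\lambda)=1,\ \nu_1'(0,\lambda)=0$ and $\nu_2(0,\lambda)=0,\ \nu_2'(0,\lambda)=1$. Then for the operator $-\frac{d^2}{dx^2}+V(x)$ on $L^2(\mathbf{R})$: (i) $\mathbb{D}(\lambda,\nu_1,\nu_2)$ is holomorphic in $\lambda\in P(a)$. (ii) For $\lambda\in P(a)$, $\mathbb{D}(\lambda,\nu_1,\nu_2)=0$ if and only if $\lambda$ is a generalized eigenvalue of $-\frac{d^2}{dx^2}+V(x)$. (iii) When $\lambda$ lies on the first Riemann sheet ($-2\pi<\arg\lambda<0$), $$\mathbb{D}(\lambda,\nu_1,\nu_2)=\frac{1}{2\sqrt{-\lambda}}\,\mathbb{E}(\lambda),$$ where $\mathbb{E}(\lambda)$ is the Evans function.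
   Context: Riemann surface and branch. $P(a)=\{\lambda\,|\,-a<\mathrm{Im}\sqrt\lambda<a\}$, a region of the Riemann surface of $\sqrt\lambda$ with the branch point $0$ removed. The first sheet is $-2\pi<\arg\lambda<0$ (where $\mathrm{Im}\sqrt\lambda<0$), the second sheet is the part $0<\arg\lambda<2\pi$ ($\mathrm{Im}\sqrt\lambda>0$); they are joined along $\arg\lambda=0$. The branch of $\sqrt{-\lambda}$ has $\mathrm{Re}\sqrt{-\lambda}>0$ on the first sheet and is continued analytically to $P(a)$ (i.e. $\sqrt{-\lambda}=\sqrt{-1}\,\sqrt\lambda$). Generalized eigenvalues. $X=L^2(\mathbf{R},e^{2a|x|}dx)$, $X'=L^2(\mathbf{R},e^{-2a|x|}dx)$; $A(\lambda)$ is the analytic continuation to $\lambda\in P(a)$ of the resolvent $(\lambda+d^2/dx^2)^{-1}$ as an operator from $X$ into $X'$, and $K^\times$ is multiplication by $V$. $\lambda\in P(a)$ is a generalized eigenvalue iff $\mu=A(\lambda)K^\times\mu$ has a nonzero solution $\mu\in X'$, where in dimension one this equation is $$\mu(x)=-\frac{1}{2\sqrt{-\lambda}}\int_x^\infty e^{-\sqrt{-\lambda}(y-x)}V(y)\mu(y)dy-\frac{1}{2\sqrt{-\lambda}}\int_{-\infty}^x e^{\sqrt{-\lambda}(y-x)}V(y)\mu(y)dy.$$ The function $\mathbb{D}$. For a solution $\mu$ of $(d^2/dx^2+\lambda-V)\mu=0$ put $$D(x,\lambda,\mu)=\mu(x,\lambda)+\frac{1}{2\sqrt{-\lambda}}\int_x^\infty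 e^{-\sqrt{-\lambda}(y-x)}V(y)\mu(y,\lambda)dy+\frac{1}{2\sqrt{-\lambda}}\int_{-\infty}^x e^{\sqrt{-\lambda}(y-x)}V(y)\mu(y,\lambda)dy,$$ and for two solutions $\mu_1,\mu_2$, $$\mathbb{D}(\lambda,\mu_1,\mu_2)=\det\begin{pmatrix} D(x,\lambda,\mu_1) & D(x,\lambda,\mu_2) \\ D'(x,\lambda,\mu_1) & D'(x,\lambda,\mu_2) \end{pmatrix},$$ where $'$ is $d/dx$; this is independent of $x$. Evans function. For $-2\pi<\arg\lambda<0$ let $\mu_\pm$ be solutions of $(d^2/dx^2+\lambda-V)\mu=0$ with $$\begin{pmatrix} \mu_+(x,\lambda) \\ \mu_+'(x,\lambda) \end{pmatrix}e^{\sqrt{-\lambda}x}\to\begin{pmatrix} 1 \\ -\sqrt{-\lambda} \end{pmatrix}\ (x\to\infty),\qquad\begin{pmatrix} \mu_-(x,\lambda) \\ \mu_-'(x,\lambda) \end{pmatrix}e^{-\sqrt{-\lambda}x}\to\begin{pmatrix} 1 \\ \sqrt{-\lambda} \end{pmatrix}\ (x\to-\infty).$$ Then $\mathbb{E}(\lambda)=\mu_+(x,\lambda)\mu_-'(x,\lambda)-\mu_+'(x,\lambda)\mu_-(x,\lambda)$, which is independent of $x$. *)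

(* Defs.v *)
From HB Require Import structures.
From mathcomp Require Import all_boot all_order all_algebra.
From mathcomp Require Import all_classical all_reals all_analysis.
From mathcomp Require Import complex.
Set Implicit Arguments.
Unset Strict Implicit.
Unset Printing Implicit Defensive.
Import Order.TTheory GRing.Theory Num.Theory.
Import numFieldNormedType.Exports.
Import ComplexField.
Local Open Scope classical_set_scope.
Local Open Scope ring_scope.
Local Open Scope complex_scope.

Definition cexp (R : realType) (z : R[i]) : R[i] :=
  (expR (complex.Re z))%:C *
  (cos (complex.Im z) +i* sin (complex.Im z)).

Definition cderivable (R : realType) (f : R -> R[i]) (x : R) : Prop :=
  derivable (fun t => complex.Re (f t)) x 1 /\
  derivable (fun t => complex.Im (f t)) x 1.

Definition cderiv (R : realType) (f : R -> R[i]) (x : R) : R[i] :=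
  (derive1 (fun t => complex.Re (f t)) x) +i*
  (derive1 (fun t => complex.Im (f t)) x).

Definition cintegrable (R : realType) (A : set R) (f : R -> R[i]) : Prop :=
  lebesgue_measure.-integrable A (fun t => (complex.Re (f t))%:E) /\
  lebesgue_measure.-integrable A (fun t => (complex.Im (f t))%:E).

Definition cintegral (R : realType) (A : set R) (f : R -> R[i]) : R[i] :=
  (\int[lebesgue_measure]_(t in A) complex.Re (f t)) +i*
  (\int[lebesgue_measure]_(t in A) complex.Im (f t)).

(* f belongs to L^2(R, w dx); f is a representative, not a class. *)
Definition in_L2 (R : realType) (w : R -> R) (f : R -> R[i]) : Prop :=
  [/\ measurable_fun setT (fun t => complex.Re (f t)),
      measurable_fun setT (fun t => complex.Im (f t)) &
      (\int[lebesgue_measure]_t (w t * Normc.normc (f t) ^+ 2)%:E < +oo)%E].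

(* Points of the Riemann surface of the square root, branch point removed,
   are represented by their global coordinate s = sqrt(lambda), s != 0; the
   projection to the lambda-plane is s |-> s^2 (a local biholomorphism), and
   arg(lambda) = 2 arg(s).  Hence -2 pi < arg(lambda) < 0 means
   -pi < arg(s) < 0, that is Im s < 0. *)
Definition lam (R : realType) (s : R[i]) : R[i] := s ^+ 2.

(* The branch of sqrt(-lambda) with Re sqrt(-lambda) = - Im s > 0 on the first
   sheet. *)
Definition sqrtN (R : realType) (s : R[i]) : R[i] := 'i * s.

Definition P (R : realType) (a : R) : set R[i] :=
  [set s | s != 0 /\ - a < complex.Im s < a].

Definition first_sheet (R : realType) : set R[i] :=
  [set s | complex.Im s < 0].

Definition holomorphic_on (K : numFieldType) (U : set K) (f : K -> K) : Prop :=
  forall s, U s -> derivable f s 1.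

(* mu'' + l mu - V mu = 0 in the sense of Caratheodory, V being only locally
   integrable: mu is differentiable, and mu' is absolutely continuous with
   a.e. derivative (V - l) mu. *)
Definition is_solution (R : realType) (V : R -> R[i]) (l : R[i])
    (mu : R -> R[i]) : Prop :=
  [/\ forall x, cderivable mu x,
      forall x y, cintegrable `[x, y] (fun t => (V t - l) * mu t) &
      forall x y, x <= y ->
        cderiv mu y - cderiv mu x =
        cintegral `[x, y] (fun t => (V t - l) * mu t)].

Section potential.
Variables (R : realType) (V : R -> R[i]).
Implicit Types (s : R[i]) (mu : R -> R[i]) (x : R).

Definition green_right s mu x : R[i] :=
  (2 * sqrtN s)^-1 *
  cintegral `[x, +oo[ (fun y => cexp (- sqrtN s * (y - x)%:C) * V y * mu y).

Definition green_left s mu x : R[i] :=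
  (2 * sqrtN s)^-1 *
  cintegral `]-oo, x] (fun y => cexp (sqrtN s * (y - x)%:C) * V y * mu y).

(* Equality in L^2(R, e^(-2a|x|) dx) is equality almost everywhere. *)
Definition generalized_eigenvalue (a : R) s : Prop :=
  exists mu : R -> R[i],
    [/\ in_L2 (fun x => expR (- (2 * a * `|x|))) mu,
        ~ {ae lebesgue_measure, forall x, mu x = 0} &
        {ae lebesgue_measure, forall x,
           mu x = - green_right s mu x - green_left s mu x}].

Definition D s mu x : R[i] := mu x + green_right s mu x + green_left s mu x.

Definition DD s mu1 mu2 x : R[i] :=
  \det (\matrix_(i < 2, j < 2)
    let mu := if j == 0 then mu1 else mu2 in
    if i == 0 then D s mu x else cderiv (D s mu) x).

Definition is_mu_plus s mu : Prop :=
  [/\ is_solution V (lam s) mu,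
      (mu x * cexp (sqrtN s * x%:C)) @[x --> +oo] --> (1 : R[i]^o) &
      (cderiv mu x * cexp (sqrtN s * x%:C)) @[x --> +oo] --> (- sqrtN s : R[i]^o)].

Definition is_mu_minus s mu : Prop :=
  [/\ is_solution V (lam s) mu,
      (mu x * cexp (- sqrtN s * x%:C)) @[x --> -oo] --> (1 : R[i]^o) &
      (cderiv mu x * cexp (- sqrtN s * x%:C)) @[x --> -oo] --> (sqrtN s : R[i]^o)].

End potential.

Definition evans (R : realType) (mup mum : R -> R[i]) (x : R) : R[i] :=
  mup x * cderiv mum x - cderiv mup x * mum x.

(* Main.v *)
Require Import Defs.
From HB Require Import structures.
From mathcomp Require Import all_boot all_order all_algebra.
From mathcomp Require Import all_classical all_reals all_analysis.
From mathcomp Require Import measurable_realfun.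
From mathcomp Require Import complex.
From mathcomp Require Import ring lra.
Set Implicit Arguments.
Unset Strict Implicit.
Unset Printing Implicit Defensive.
Import Order.TTheory GRing.Theory Num.Theory.
Import numFieldNormedType.Exports.
Local Open Scope classical_set_scope.
Local Open Scope ring_scope.
Local Open Scope complex_scope.

(** Put k = sqrtN s, so that the equation reads mu'' = (V + k^2) mu. Then V * mu
    is mu'' - k^2 * mu, and cexp (- k y) * V y * mu y is the derivative of
    cexp (- k y) * (mu' y + k * mu y). Hence both integrals in D can be evaluated,
    and for every solution mu
      D x = (2 k)^-1 * (cexp (k x) * p + cexp (- k x) * q),
    where p is the limit at +oo of cexp (- k x) * (mu' x + k * mu x) and q is the
    same limit for the reflected data ([D_solution]). The determinant DD is
    therefore (2 k)^-1 * (q1 * p2 - p1 * q2), with p and q taken at nu1 and nu2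
    ([DD_solution]). The three claims are statements about these coefficients.

    Holomorphy. The functions phi = cexp (- k x) * mu and
    u = cexp (- k x) * (mu' + k * mu) satisfy phi' = u - 2 k phi and u' = V phi,
    a system that is linear in k and in which p is the limit of u. A weighted
    energy estimate ([energy_bound]) bounds phi at any rate c above
    max (0, - 2 Re k), uniformly for k in a small disc. Applied to phi, to its
    first difference in k and to its second-order remainder, it gives an
    expansion p (k + h) = p k + h * L + O (h^2) as long as c can be chosen below
    the decay rate 2 a of V, that is for Re k > - a ([plus_coef_holomorphic]).

    Generalized eigenvalues. If DD vanishes, some nonzero combination of nu1 and
    nu2 has p = q = 0, so that D vanishes on it; it grows at a rate below a, hence
    lies in the weighted space ([eigenvalue_of_DD0]). Conversely the right-hand
    side of the integral equation is a solution of the differential equation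
    with p = q = 0 ([DD0_of_eigenvalue]).

    Evans function. For Re k > 0 the Wronskian of mu_+ with a solution is its p,
    and that of the reflected mu_- is its q ([jost_plus_coef]). At 0 these are the
    initial values of mu_+ and mu_-.

    The potential is only locally integrable, so that derivatives are understood
    through integrals ([primitive]). The product rule for such functions is
    proved without differentiation almost everywhere: a function whose increments
    are bounded by the squares of those of a continuous monotone function is
    constant ([cst_of_quadratic_increments]). *)

(** * Primitives of locally integrable functions *)

Section primitive.
Context {R : realType}.
Local Notation leb := (@lebesgue_measure R).
Implicit Types (f g h F G K : R -> R) (x y z : R).

Definition locint f := forall x y, leb.-integrable `[x, y] (EFin \o f).

(** Absolute continuity in integrated form. With a locally integrable potential
    the derivative of a solution is F for such a pair, and need not be
    differentiable at each point. *)
Definition primitive F f :=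
  locint f /\ forall x y, x <= y -> F y - F x = \int[leb]_(t in `[x, y]) f t.

Lemma locint_continuous f : continuous f -> locint f.
Proof.
move=> cf x y; apply: continuous_compact_integrable.
  exact: segment_compact.
exact: continuous_subspaceT.
Qed.

Lemma locint_eq f g : f =1 g -> locint f -> locint g.
Proof. by move=> /funext <-. Qed.

Lemma locint_cst (c : R) : locint (fun=> c).
Proof. by apply: locint_continuous => ?; exact: cvg_cst. Qed.

Lemma locintD f g : locint f -> locint g -> locint (fun t => f t + g t).
Proof.
move=> lf lg x y.
rewrite (_ : _ \o _ = (EFin \o f) \+ (EFin \o g))%E; first exact: integrableD.
by apply/funext => t /=; rewrite EFinD.
Qed.

Lemma locintN f : locint f -> locint (fun t => - f t).
Proof.
move=> lf x y.
rewrite (_ : _ \o _ = -%E \o (EFin \o f))%E; first exact: integrableN.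
by apply/funext => t.
Qed.

Lemma locintZ k f : locint f -> locint (fun t => k * f t).
Proof.
move=> lf x y.
rewrite (_ : _ \o _ = (fun t => k%:E * (EFin \o f) t))%E; first exact: integrableZl.
by apply/funext => t.
Qed.

Lemma locint_norm f : locint f -> locint (fun t => `|f t|).
Proof. by move=> lf x y; exact: (integrable_norm (lf x y)). Qed.

Lemma locintMc f g : locint f -> continuous g -> locint (fun t => f t * g t).
Proof.
move=> lf cg x y.
rewrite (_ : _ \o _ = (EFin \o f) \* (EFin \o g))%E; last first.
  by apply/funext => t /=; rewrite EFinM.
apply: integrableMl => //.
  by apply: measurable_funTS; exact: continuous_measurable_fun.
have /compact_bounded : compact (g @` `[x, y]).
  apply: continuous_compact; last exact: segment_compact.
  exact: continuous_subspaceT.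
move=> [M [Mreal hM]]; exists M; split=> // N MN t txy.
by apply: (hM N MN); exists t.
Qed.

Lemma Rint_cat f x y z : locint f -> x <= y -> y <= z ->
  \int[leb]_(t in `[x, z]) f t =
  \int[leb]_(t in `[x, y]) f t + \int[leb]_(t in `[y, z]) f t.
Proof.
move=> lf xy yz.
have := @Rintegral_itvB R f (BLeft x) (BRight z) y (lf x z).
rewrite !bnd_simp => /(_ xy yz).
rewrite Rintegral_itv_obnd_cbnd; last first.
  apply: integrableS (lf y z) => //.
  by apply: subset_itvr; rewrite bnd_simp.
by move=> <-; rewrite addrC subrK.
Qed.

Lemma locint_primitive f : locint f -> exists F, primitive F f.
Proof.
move=> lf.
exists (fun x => if 0 <= x then \int[leb]_(t in `[0, x]) f t
                 else - \int[leb]_(t in `[x, 0]) f t).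
split => // x y xy.
have [x0|x0] := leP 0 x.
  rewrite (le_trans x0 xy) (Rint_cat lf x0 xy); lra.
have [y0|y0] := leP 0 y.
  rewrite (Rint_cat lf (ltW x0) y0); lra.
rewrite (Rint_cat lf xy (ltW y0)); lra.
Qed.

Lemma primitive_eq F G f g : F =1 G -> f =1 g -> primitive F f -> primitive G g.
Proof. by move=> /funext <- /funext <-. Qed.

Lemma primitive_cst (c : R) : primitive (fun=> c) (fun=> 0).
Proof.
split=> [|x y _]; first exact: locint_cst.
by rewrite subrr Rintegral_cst// mul0r.
Qed.

Lemma primitiveD F G f g : primitive F f -> primitive G g ->
  primitive (fun t => F t + G t) (fun t => f t + g t).
Proof.
move=> [lf pF] [lg pG]; split; first exact: locintD.
by move=> x y xy; rewrite RintegralD// -pF// -pG//; lra.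
Qed.

Lemma primitiveZ k F f : primitive F f ->
  primitive (fun t => k * F t) (fun t => k * f t).
Proof.
move=> [lf pF]; split; first exact: locintZ.
by move=> x y xy; rewrite RintegralZl// -pF//; lra.
Qed.

Lemma primitiveN F f : primitive F f ->
  primitive (fun t => - F t) (fun t => - f t).
Proof.
by move/(primitiveZ (-1)); apply: primitive_eq => t; rewrite mulN1r.
Qed.

Lemma primitiveB F G f g : primitive F f -> primitive G g ->
  primitive (fun t => F t - G t) (fun t => f t - g t).
Proof. by move=> pF /primitiveN; exact: primitiveD. Qed.

Lemma primitive_continuous F f : primitive F f -> continuous F.
Proof.
move=> [lf pF] x.
have ab : x - 1 <= x + 1 by lra.
have := parameterized_integral_continuous ab (lf _ _).
rewrite /parameterized_integral => /continuous_within_itvP.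
have ab' : x - 1 < x + 1 by lra.
move=> /(_ ab')[+ _ _] => /(_ x); rewrite in_itv/=.
have -> : x - 1 < x < x + 1 by apply/andP; split; lra.
move=> /(_ isT) /(cvgD (@cvg_cst _ (F (x - 1)) _ _ _)) => H.
rewrite /continuous_at.
have -> : F x = F (x - 1) + \int[leb]_(t in `[x - 1, x]) f t.
  by rewrite -pF; lra.
apply: cvg_trans H; apply: near_eq_cvg.
near=> t; rewrite fctE -pF; first by lra.
apply/ltW; near: t; apply: (open_gt (y := x - 1)) => /=; lra.
Unshelve. all: by end_near. Qed.

Lemma primitive_le F f x y : primitive F f -> x <= y ->
  (forall t, x <= t <= y -> f t <= 0) -> F y <= F x.
Proof.
move=> [lf pF] xy f0; rewrite -subr_le0 pF//.
have -> : 0 = \int[leb]_(t in `[x, y]) 0 by rewrite Rintegral_cst// mul0r.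
by apply: le_Rintegral => //; exact: (locint_cst 0).
Qed.

Lemma primitive_norm F f K x y : primitive F f -> primitive K (fun t => `|f t|) ->
  x <= y -> `|F y - F x| <= K y - K x.
Proof.
move=> [lf pF] [lK pK] xy; rewrite pF// pK//.
exact: le_normr_Rintegral.
Qed.

Lemma primitive_norm_le F f K k x y : primitive F f -> primitive K k ->
  x <= y -> (forall t, x <= t <= y -> `|f t| <= k t) ->
  `|F y - F x| <= K y - K x.
Proof.
move=> [lf pF] [lK pK] xy fk; rewrite pF// pK//.
apply: le_trans (le_normr_Rintegral _ _) _ => //.
by apply: le_Rintegral => //; exact: locint_norm.
Qed.

(** By the intermediate value theorem K takes its mean value inside a segment;
    cutting there halves the bound on the increment of Phi. Hence this increment
    is at most 2^-n times the first bound, for all n. This is what makes the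
    product and chain rules below elementary: the defect of each rule has
    increments of second order. *)
Lemma cst_of_quadratic_increments (Phi K : R -> R) (a b C : R) : a <= b ->
  continuous K ->
  (forall x y, a <= x -> x <= y -> y <= b -> K x <= K y) ->
  (forall x y, a <= x -> x <= y -> y <= b ->
     `|Phi y - Phi x| <= C * (K y - K x) ^+ 2) ->
  Phi b = Phi a.
Proof.
move=> ab cK ndK qP.
have halve n x y : a <= x -> x <= y -> y <= b ->
    `|Phi y - Phi x| <= C * (K y - K x) ^+ 2 / 2 ^+ n.
  elim: n x y => [|n IH] x y ax xy yb.
    by rewrite expr0 divr1; exact: qP.
  have Kxy := ndK x y ax xy yb.
  have [c /[!in_itv]/= /andP[xc cy] Kc] : exists2 c, c \in `[x, y] &
      K c = (K x + K y) / 2.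
    apply: IVT => //; first exact: continuous_subspaceT.
    by rewrite min_l// max_r//; apply/andP; split; lra.
  have h1 := IH x c ax xc (le_trans cy yb).
  have h2 := IH c y (le_trans ax xc) cy yb.
  have -> : Phi y - Phi x = (Phi y - Phi c) + (Phi c - Phi x) by lra.
  apply: le_trans (ler_normD _ _) _.
  apply: le_trans (lerD h2 h1) _.
  rewrite Kc (exprS 2 n) invfM.
  set p := (2 ^+ n)^-1; nra.
apply/eqP; rewrite -subr_eq0; apply/negP => /negP; rewrite -normr_gt0 => P0.
pose D := C * (K b - K a) ^+ 2.
pose n := Num.bound (D / `|Phi b - Phi a|).
have := halve n a b (lexx _) ab (lexx _); rewrite leNgt => /negP; apply.
rewrite ltr_pdivrMr ?exprn_gt0// [ltRHS]mulrC -ltr_pdivrMr//.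
exact: upper_nthrootP.
Qed.

Lemma primitiveM F G f g : primitive F f -> primitive G g ->
  primitive (fun t => F t * G t) (fun t => f t * G t + F t * g t).
Proof.
move=> pF pG.
have [lf dF] := pF; have [lg dG] := pG.
have cF := primitive_continuous pF; have cG := primitive_continuous pG.
have lfG := locintMc lf cG.
have lFg : locint (fun t => F t * g t).
  by apply: locint_eq (locintMc lg cF) => t; rewrite mulrC.
have lh := locintD lfG lFg.
split=> // a b ab.
have [J [_ pJ]] := locint_primitive lh.
have lk := locintD (locint_norm lf) (locint_norm lg).
have [K pK] := locint_primitive lk.
have [_ dK] := pK.
have incK x y : x <= y -> 0 <= K y - K x.
  by move=> xy; rewrite dK// Rintegral_ge0// => t _; rewrite addr_ge0.
have bF x y : x <= y -> `|F y - F x| <= K y - K x.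
  by move=> xy; apply: primitive_norm_le pF pK xy _ => t _; rewrite lerDl.
have bG x y : x <= y -> `|G y - G x| <= K y - K x.
  by move=> xy; apply: primitive_norm_le pG pK xy _ => t _; rewrite lerDr.
rewrite -pJ//; suff : F b * G b - J b = F a * G a - J a by lra.
apply: (@cst_of_quadratic_increments (fun t => F t * G t - J t) K a b 1) => //.
- exact: primitive_continuous pK.
- by move=> x y _ xy _; rewrite -subr_ge0 incK.
move=> x y _ xy _; rewrite mul1r.
(* The defect is the integral over [x, y] of
   f t * (G y - G t) + (F x - F t) * g t. *)
pose M := K y - K x.
have pM : primitive (fun t => M * K t) (fun t => M * (`|f t| + `|g t|)).
  exact: primitiveZ.
have pd : primitive (fun t => (G y * F t + F x * G t) - J t)
    (fun t => (G y * f t + F x * g t) - (f t * G t + F t * g t)).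
  apply: primitiveB => //; apply: primitiveD; exact: primitiveZ.
have := primitive_norm_le pd pM xy.
rewrite -[M * K y - M * K x]mulrBr -/M -expr2.
have -> : G y * F y + F x * G y - J y - (G y * F x + F x * G x - J x) =
   F y * G y - J y - (F x * G x - J x) by ring.
apply => t /andP[xt ty].
have -> : G y * f t + F x * g t - (f t * G t + F t * g t) =
  f t * (G y - G t) + (F x - F t) * g t by ring.
apply: le_trans (ler_normD _ _) _; rewrite !normrM.
have h1 := bG _ _ ty; have h2 := bF _ _ xt.
have i1 := incK _ _ ty; have i2 := incK _ _ xt.
rewrite distrC in h2.
have h1' : `|G y - G t| <= M by rewrite /M; lra.
have h2' : `|F x - F t| <= M by rewrite /M; lra.
have := normr_ge0 (f t); have := normr_ge0 (g t); nra.
Qed.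

Lemma expR_tangent (u v : R) : expR v + expR v * (u - v) <= expR u.
Proof.
have := expR_ge1Dx (u - v); rewrite expRD expRN.
move/(ler_wpM2l (expR_ge0 v)).
by rewrite mulrCA divff ?mulr1 ?mulrDr ?mulr1// gt_eqF// expR_gt0.
Qed.

Lemma expR_lipschitz (u v M : R) : expR u <= M -> expR v <= M ->
  `|expR u - expR v| <= M * `|u - v|.
Proof.
wlog uv : u v / u <= v => [hw uM vM|uM vM].
  have [uv|/ltW vu] := leP u v; first exact: hw.
  by rewrite distrC (distrC u); exact: hw.
rewrite ler0_norm ?subr_le0 ?ler_expR// ler0_norm ?subr_le0//.
have := expR_tangent u v; nra.
Qed.

Lemma expR_taylor1 (u v M : R) : expR u <= M -> expR v <= M ->
  `|expR u - expR v - expR v * (u - v)| <= M * (u - v) ^+ 2.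
Proof.
move=> uM vM.
have h1 := expR_tangent u v; have h2 := expR_tangent v u.
rewrite ger0_norm; last by lra.
apply: le_trans (_ : _ <= (expR u - expR v) * (u - v)) _; first lra.
apply: le_trans (ler_norm _) _; rewrite normrM -[in leRHS]real_normK ?num_real//.
by rewrite expr2 mulrA ler_wpM2r// expR_lipschitz.
Qed.

(** The defect over [x, y] splits into the Taylor remainder of expR between F x
    and F y and the integral of f t * (expR (F x) - expR (F t)), both of second
    order in the increment of a primitive of |f|. *)
Lemma primitive_expR F f : primitive F f ->
  primitive (fun t => expR (F t)) (fun t => f t * expR (F t)).
Proof.
move=> pF; have [lf dF] := pF; have cF := primitive_continuous pF.
have cE : continuous (fun t => expR (F t)).
  by move=> t; apply: continuous_comp; [exact: cF|exact: continuous_expR].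
have lh := locintMc lf cE.
split=> // a b ab.
have [J pJ] := locint_primitive lh; have [_ dJ] := pJ.
have [K pK] := locint_primitive (locint_norm lf).
have [_ dK] := pK.
have incK x y : x <= y -> 0 <= K y - K x.
  by move=> xy; rewrite dK// Rintegral_ge0.
have bF x y : x <= y -> `|F y - F x| <= K y - K x.
  by move=> xy; exact: primitive_norm pF pK xy.
pose M := expR (F a + (K b - K a)).
have eM t : a <= t -> t <= b -> expR (F t) <= M.
  move=> a_t tb; rewrite ler_expR.
  by have := ler_normlW (bF _ _ a_t); have := incK _ _ tb; lra.
rewrite -dJ//; suff : expR (F b) - J b = expR (F a) - J a by lra.
apply: (@cst_of_quadratic_increments (fun t => expR (F t) - J t) K a b (2 * M)).
- by [].
- exact: primitive_continuous pK.
- by move=> x y _ xy _; rewrite -subr_ge0 incK.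
move=> x y ax xy yb.
have M0 : 0 <= M by exact: expR_ge0.
have xb := le_trans xy yb; have ay := le_trans ax xy.
pose d := K y - K x.
have d0 : 0 <= d by exact: incK.
have t1 : `|expR (F y) - expR (F x) - expR (F x) * (F y - F x)| <= M * d ^+ 2.
  apply: le_trans (expR_taylor1 (eM _ ay yb) (eM _ ax xb)) _.
  apply: ler_wpM2l => //; rewrite -real_normK ?num_real//.
  by rewrite lerXn2r ?nnegrE//; exact: bF.
have t2 : `|expR (F x) * (F y - F x) - (J y - J x)| <= M * d ^+ 2.
  have pM : primitive (fun t => (M * d) * K t) (fun t => (M * d) * `|f t|).
    exact: primitiveZ.
  have pd : primitive (fun t => expR (F x) * F t - J t)
      (fun t => expR (F x) * f t - f t * expR (F t)).
    by apply: primitiveB => //; exact: primitiveZ.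
  have := primitive_norm_le pd pM xy.
  have -> : M * d * K y - M * d * K x = M * d ^+ 2 by rewrite /d; ring.
  have -> : expR (F x) * F y - J y - (expR (F x) * F x - J x) =
    expR (F x) * (F y - F x) - (J y - J x) by ring.
  apply => t /andP[xt ty].
  have -> : expR (F x) * f t - f t * expR (F t) =
    (expR (F x) - expR (F t)) * f t by ring.
  rewrite normrM ler_wpM2r//.
  have ext : `|expR (F x) - expR (F t)| <= M * `|F x - F t|.
    by apply: expR_lipschitz; apply: eM => //; [exact: le_trans xt|exact: le_trans yb].
  apply: le_trans ext _; apply: ler_wpM2l => //.
  rewrite distrC; apply: le_trans (bF _ _ xt) _.
  by have := incK _ _ ty; rewrite /d; lra.
have -> : expR (F y) - J y - (expR (F x) - J x) =
  (expR (F y) - expR (F x) - expR (F x) * (F y - F x)) +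
  (expR (F x) * (F y - F x) - (J y - J x)) by ring.
apply: le_trans (ler_normD _ _) _; rewrite -/d; lra.
Qed.

End primitive.

(** * Fundamental theorem, reflections and half-lines *)

Section primitive_calculus.
Context {R : realType}.
Local Notation leb := (@lebesgue_measure R).
Implicit Types (f g h F G K : R -> R) (x y z : R).

Lemma primitive_of_derive F f : continuous f ->
  (forall x, is_derive x 1 F (f x)) -> primitive F f.
Proof.
move=> cf dF; have lf := locint_continuous cf.
have cF : continuous F.
  move=> x; apply: differentiable_continuous; apply/derivable1_diffP.
  by have [] := dF x.
split => // x y; rewrite le_eqVlt => /predU1P[->|xy].
  by rewrite subrr set_itv1 Rintegral_set1.
rewrite /Rintegral (@continuous_FTC2 R f F x y) ?fineD//.
- by apply: continuous_subspaceT.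
- split.
  + by move=> z _; have [] := dF z.
  + by apply: cvg_at_right_filter; exact: cF.
  + by apply: cvg_at_left_filter; exact: cF.
- by move=> z _; rewrite derive1E; have [_ ->] := dF z.
Qed.

Lemma primitive_is_derive F f x : primitive F f -> continuous f ->
  is_derive x 1 F (f x).
Proof.
move=> [lf dF] cf.
have xu : x < x + 1 by lra.
have ax : x - 1 < x by lra.
have [dI I'] := continuous_FTC1_closed xu (lf (x - 1) (x + 1)) ax (cf x).
pose I t := \int[leb]_(u in `[x - 1, t]) f u.
apply: (@near_eq_is_derive _ _ _ (fun t => F (x - 1) + I t)).
  near=> t; rewrite /= /I -dF; first by lra.
  apply/ltW; near: t; apply: (open_gt (y := x - 1)) => /=; lra.
have dII : is_derive x 1 I (f x).
  by apply: DeriveDef; [exact: dI|rewrite -I' derive1E].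
rewrite -[f x]add0r.
have -> : (fun t => F (x - 1) + I t) = cst (F (x - 1)) + I by apply/funext.
exact: is_deriveD.
Unshelve. all: by end_near. Qed.

Lemma primitive_linear (c : R) : primitive (fun t => c * t) (fun=> c).
Proof.
apply: primitive_of_derive => [|x]; first exact: cst_continuous.
have -> : (fun t => c * t) = c *: (id : R -> R) by apply/funext.
by apply: is_derive_eq; rewrite /GRing.scale/= mulr1.
Qed.

Lemma primitive_unique F G f : primitive F f -> primitive G f ->
  forall x y, F x - G x = F y - G y.
Proof.
move=> [_ pF] [_ pG].
suff H x y : x <= y -> F x - G x = F y - G y.
  by move=> x y; have [/H//|/ltW/H ->] := leP x y.
by move=> xy; have := pF x y xy; have := pG x y xy; lra.
Qed.

Lemma primitive0_cst F : primitive F (fun=> 0) -> forall x y, F x = F y.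
Proof.
move=> pF x y; have := primitive_unique pF (primitive_cst 0) x y.
by rewrite !subr0.
Qed.

Lemma integrable_dominated (D : set R) f g : measurable D ->
  measurable_fun D f -> leb.-integrable D (EFin \o g) ->
  (forall x, D x -> `|f x| <= g x) -> leb.-integrable D (EFin \o f).
Proof.
move=> mD mf ig fg; apply: le_integrable ig => //.
  exact/measurable_EFinP.
move=> x Dx; rewrite /= lee_fin; apply: (le_trans (fg x Dx)).
exact: ler_norm.
Qed.

Lemma integrable_union (A B : set (measurableTypeR R)) f :
  measurable A -> measurable B -> leb.-integrable A (EFin \o f) ->
  leb.-integrable B (EFin \o f) -> leb.-integrable (A `|` B) (EFin \o f).
Proof.
move=> mA mB iA iB; have mAB := measurableU _ _ mA mB.
pose g : R -> R := fun x => ((Num.norm \o f) \_ A) x + ((Num.norm \o f) \_ B) x.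
apply: (@integrable_dominated _ _ g) => //.
- apply/measurable_funU => //; split.
    by apply/measurable_EFinP; exact: measurable_int iA.
  by apply/measurable_EFinP; exact: measurable_int iB.
- apply: (@integrableS _ _ _ leb setT) => //.
  rewrite (_ : _ \o g = (EFin \o ((Num.norm \o f) \_ A)) \+
                        (EFin \o ((Num.norm \o f) \_ B)))%E; last exact/funext.
  have /(integrable_mkcond _ mA) := integrable_norm iA.
  have /(integrable_mkcond _ mB) := integrable_norm iB.
  by rewrite !restrict_EFin => ? ?; exact: integrableD.
move=> x [xA|xB]; rewrite /g /patch; [rewrite (mem_set xA)|rewrite (mem_set xB)].
  by rewrite lerDl; case: ifP => //= _; rewrite normr_ge0.
by rewrite lerDr; case: ifP => //= _; rewrite normr_ge0.
Qed.

Lemma integrable_opp f : leb.-integrable setT (EFin \o f) ->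
  leb.-integrable setT (EFin \o (fun x => f (- x))) /\
  \int[leb]_x f (- x) = \int[leb]_x f x.
Proof.
move=> /[dup] iF /integrableP[mf fi].
have mN : measurable_fun setT (-%R : measurableTypeR R -> measurableTypeR R).
  exact: oppr_measurable.
have fN : leb.-integrable setT (EFin \o (fun x => f (- x))).
  apply/integrableP; split.
    exact: (measurableT_comp mf mN).
  rewrite (_ : \int[leb]_x _ = \int[leb]_x `|(EFin \o f) x|)%E//.
  transitivity (\int[pushforward leb (-%R : R -> measurableTypeR R)]_x `|(EFin \o f) x|)%E.
    rewrite ge0_integral_pushforward//.
    exact: measurableT_comp.
  by apply: eq_measure_integral => //= A mA _; exact: lebesgue_measureN.
split=> //; rewrite /Rintegral; congr fine.
transitivity (\int[pushforward leb (-%R : R -> measurableTypeR R)]_x (f x)%:E)%E.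
  by rewrite integral_pushforward.
by apply: eq_measure_integral => //= A mA _; exact: lebesgue_measureN.
Qed.

Lemma integrable_opp_on (D : set (measurableTypeR R)) f : measurable D ->
  leb.-integrable D (EFin \o f) ->
  leb.-integrable (-%R @^-1` D) (EFin \o (fun x => f (- x))) /\
  \int[leb]_(x in -%R @^-1` D) f (- x) = \int[leb]_(x in D) f x.
Proof.
move=> mD; have mND : measurable (-%R @^-1` D : set (measurableTypeR R)).
  by rewrite -[X in measurable X]setTI; exact: oppr_measurable.
move=> /(integrable_mkcond _ mD); rewrite restrict_EFin => /integrable_opp.
have -> : (fun x => (f \_ D) (- x)) = (fun x => f (- x)) \_ (-%R @^-1` D).
  by [].
move=> [iN eN]; split.
  by apply/(integrable_mkcond _ mND); rewrite restrict_EFin.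
rewrite Rintegral_mkcond [RHS]Rintegral_mkcond -eN.
by [].
Qed.

Lemma primitive_opp F f : primitive F f ->
  primitive (fun t => F (- t)) (fun t => - f (- t)).
Proof.
move=> [lf pF].
have ipre x y : (-%R @^-1` `[x, y] : set R) = `[- y, - x]%classic.
  by rewrite opp_preimage_itvbndbnd.
have lN : locint (fun t => f (- t)).
  move=> x y; have [+ _] := integrable_opp_on (measurable_itv `[- y, - x]) (lf _ _).
  by rewrite ipre !opprK.
split; first exact: locintN.
move=> x y xy.
have [_] := integrable_opp_on (measurable_itv `[- y, - x]) (lf _ _).
rewrite ipre !opprK -pF ?lerN2// => h.
transitivity (\int[leb]_(t in `[x, y]) (-1 * f (- t))).
  by rewrite RintegralZl// h; lra.
by apply: eq_Rintegral => t _; rewrite mulN1r.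
Qed.

Lemma integral_ray F f x : primitive F f ->
  leb.-integrable `[0, +oo[ (EFin \o f) ->
  leb.-integrable `[x, +oo[ (EFin \o f) /\
  \int[leb]_(t in `[x, +oo[) f t =
    \int[leb]_(t in `[0, +oo[) f t - (F x - F 0).
Proof.
move=> [lf pF] if0.
have cut y z : y <= z -> leb.-integrable `[y, +oo[ (EFin \o f) ->
    \int[leb]_(t in `[y, +oo[) f t =
    \int[leb]_(t in `[y, z]) f t + \int[leb]_(t in `[z, +oo[) f t.
  move=> yz iy; have := @Rintegral_itvB R f (BLeft y) +oo%O z iy.
  rewrite !bnd_simp => /(_ yz isT).
  rewrite Rintegral_itv_obnd_cbnd; last first.
    apply: integrableS iy => //; apply: subset_itvr; rewrite bnd_simp.
    by [].
  by move=> <-; rewrite addrC subrK.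
have [x0|/ltW x0] := leP 0 x.
  split; last by rewrite (cut 0 x)// -pF//; lra.
  by apply: integrableS if0 => //; apply: subset_itvr; rewrite bnd_simp.
have ix : leb.-integrable `[x, +oo[ (EFin \o f).
  have -> : `[x, +oo[%classic = `[x, 0]%classic `|` `[0, +oo[%classic.
    apply/seteqP; split => t /=; rewrite !in_itv/= ?andbT.
      by move=> xt; have [?|/ltW ?] := leP 0 t; [right|left; apply/andP].
    by case=> [/andP[]//|]; exact: le_trans.
  exact: integrable_union.
by split=> //; rewrite (cut x 0)// -pF//; lra.
Qed.

Lemma integrable_expR_abs (e : R) : 0 < e ->
  leb.-integrable setT (EFin \o (fun x => expR (- (e * `|x|)))).
Proof.
move=> e0.
have ip := integrable_exponential_pdf e0.
have [im _] := integrable_opp ip.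
(* Both half-lines are dominated by densities of exponential laws. *)
pose g x := e^-1 * (exponential_pdf e x + exponential_pdf e (- x)).
apply: (@integrable_dominated _ _ g) => //.
- apply: continuous_measurable_fun => x.
  apply: continuous_comp; last exact: continuous_expR.
  apply: cvgN; apply: cvgM; first exact: cvg_cst.
  exact: norm_continuous.
- rewrite /g (_ : _ \o _ = (fun x => (e^-1)%:E * ((EFin \o exponential_pdf e) \+
     (EFin \o (fun x => exponential_pdf e (- x)%R))) x)%E); last by apply/funext.
  by apply: integrableZl => //; exact: integrableD.
move=> x _; rewrite /g ger0_norm ?expR_ge0//.
rewrite [leRHS]mulrC ler_pdivlMr//.
have h y : 0 <= y -> exponential_pdf e y = expR (- (e * y)) * e.
  by move=> y0; rewrite exponential_pdfE// mulrC mulNr.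
have [x0|/ltW x0] := leP 0 x.
  by rewrite (h x)// ger0_norm// lerDl exponential_pdf_ge0// ltW.
rewrite (h (- x)) ?oppr_ge0// ler0_norm//.
by rewrite lerDr exponential_pdf_ge0// ltW.
Qed.

End primitive_calculus.

(** * Complex-valued functions and the equation as a system *)

Section complex_calculus.
Context {R : realType}.
Local Notation C := R[i].
Local Notation Re := (@complex.Re R).
Local Notation Im := (@complex.Im R).
Local Notation normc := (@Normc.normc R).
Implicit Types (f g h F G K : R -> C) (x y z : C).

Lemma cRe0 : Re 0 = 0. Proof. by []. Qed.
Lemma cIm0 : Im 0 = 0. Proof. by []. Qed.
Lemma cRe1 : Re 1 = 1. Proof. by []. Qed.
Lemma cIm1 : Im 1 = 0. Proof. by []. Qed.
Lemma cReN x : Re (- x) = - Re x. Proof. by case: x. Qed.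
Lemma cImN x : Im (- x) = - Im x. Proof. by case: x. Qed.
Lemma cReD x y : Re (x + y) = Re x + Re y. Proof. by case: x y => ? ? []. Qed.
Lemma cImD x y : Im (x + y) = Im x + Im y. Proof. by case: x y => ? ? []. Qed.
Lemma cReM x y : Re (x * y) = Re x * Re y - Im x * Im y.
Proof. by case: x y => ? ? []. Qed.
Lemma cImM x y : Im (x * y) = Re x * Im y + Im x * Re y.
Proof. by case: x y => ? ? []. Qed.
Lemma cReC (r : R) : Re r%:C = r. Proof. by []. Qed.
Lemma cImC (r : R) : Im r%:C = 0. Proof. by []. Qed.

Definition creim := (cReD, cImD, cReN, cImN, cReM, cImM, cReC, cImC,
  cRe0, cIm0, cRe1, cIm1).

Lemma complex_eq x y : Re x = Re y -> Im x = Im y -> x = y.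
Proof. by case: x y => ? ? [? ?] /= -> ->. Qed.

Definition normsq (z : C) : R := Re z ^+ 2 + Im z ^+ 2.

Lemma normsq_ge0 z : 0 <= normsq z.
Proof. by rewrite addr_ge0 ?sqr_ge0. Qed.

Lemma normcE (z : C) : normc z = Num.sqrt (normsq z).
Proof. by case: z. Qed.

Lemma sqr_normc (z : C) : normc z ^+ 2 = normsq z.
Proof. by rewrite normcE sqr_sqrtr// normsq_ge0. Qed.

Lemma normc_ge0 (z : C) : 0 <= normc z.
Proof. by rewrite normcE sqrtr_ge0. Qed.

Lemma complex_normE (z : C) : `|z| = (normc z)%:C.
Proof. by rewrite normc_def normcE. Qed.

Lemma le_Re_normc (z : C) : `|Re z| <= normc z.
Proof.
rewrite normcE -sqrtr_sqr; apply: ler_wsqrtr.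
by rewrite /normsq lerDl sqr_ge0.
Qed.

Lemma le_Im_normc (z : C) : `|Im z| <= normc z.
Proof.
rewrite normcE -sqrtr_sqr; apply: ler_wsqrtr.
by rewrite /normsq lerDr sqr_ge0.
Qed.

Lemma normc_le_ReIm (z : C) : normc z <= `|Re z| + `|Im z|.
Proof.
rewrite -(ler_pXn2r (n := 2)) ?nnegrE ?addr_ge0 ?normc_ge0//.
rewrite sqr_normc /normsq sqrrD !real_normK ?num_real//.
have : 0 <= `|Re z| * `|Im z| by rewrite mulr_ge0.
by rewrite mulr2n; lra.
Qed.

Lemma normsqM x y : normsq (x * y) = normsq x * normsq y.
Proof. by rewrite -!sqr_normc Normc.normcM exprMn. Qed.

Lemma cexp0 : cexp (0 : C) = 1.
Proof. by apply: complex_eq; rewrite /cexp !creim/= expR0 cos0 sin0; lra. Qed.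

Lemma cexpD x y : cexp (x + y) = cexp x * cexp y.
Proof.
apply: complex_eq; rewrite /cexp !creim/= expRD cosD sinD; ring.
Qed.

Lemma cexpN x : cexp (- x) * cexp x = 1.
Proof. by rewrite -cexpD addNr cexp0. Qed.

Lemma normsq_cexp x : normsq (cexp x) = expR (2 * Re x).
Proof.
rewrite /normsq /cexp !creim/= [2 * _]mulrC mulr_natr mulr2n expRD.
have := cos2Dsin2 (Im x); set c := cos _; set s := sin _ => h.
transitivity (expR (Re x) * expR (Re x) * (c ^+ 2 + s ^+ 2)); first by ring.
by rewrite h mulr1.
Qed.

Lemma normc_cexp x : normc (cexp x) = expR (Re x).
Proof.
rewrite normcE normsq_cexp mulr_natl mulr2n expRD -expr2.
by rewrite sqrtr_sqr ger0_norm// expR_ge0.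
Qed.

Definition cprimitive F f :=
  primitive (fun t => Re (F t)) (fun t => Re (f t)) /\
  primitive (fun t => Im (F t)) (fun t => Im (f t)).

Lemma cprimitive_eq F G f g : F =1 G -> f =1 g -> cprimitive F f -> cprimitive G g.
Proof. by move=> /funext <- /funext <-. Qed.

Lemma cprimitive_cst (c : C) : cprimitive (fun=> c) (fun=> 0).
Proof. by split; exact: primitive_cst. Qed.

Lemma cprimitiveD F G f g : cprimitive F f -> cprimitive G g ->
  cprimitive (fun t => F t + G t) (fun t => f t + g t).
Proof.
move=> [pF1 pF2] [pG1 pG2]; split.
  by apply: primitive_eq (primitiveD pF1 pG1) => t; rewrite !creim.
by apply: primitive_eq (primitiveD pF2 pG2) => t; rewrite !creim.
Qed.

Lemma cprimitiveN F f : cprimitive F f -> cprimitive (fun t => - F t) (fun t => - f t).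
Proof.
move=> [pF1 pF2]; split.
  by apply: primitive_eq (primitiveN pF1) => t; rewrite !creim.
by apply: primitive_eq (primitiveN pF2) => t; rewrite !creim.
Qed.

Lemma cprimitiveB F G f g : cprimitive F f -> cprimitive G g ->
  cprimitive (fun t => F t - G t) (fun t => f t - g t).
Proof. by move=> pF /cprimitiveN; exact: cprimitiveD. Qed.

Lemma cprimitiveM F G f g : cprimitive F f -> cprimitive G g ->
  cprimitive (fun t => F t * G t) (fun t => f t * G t + F t * g t).
Proof.
move=> [pF1 pF2] [pG1 pG2]; split.
  apply: primitive_eq (primitiveB (primitiveM pF1 pG1) (primitiveM pF2 pG2)) => t;
    rewrite !creim; ring.
apply: primitive_eq (primitiveD (primitiveM pF1 pG2) (primitiveM pF2 pG1)) => t;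
  rewrite !creim; ring.
Qed.

Lemma cprimitiveZ (c : C) F f : cprimitive F f ->
  cprimitive (fun t => c * F t) (fun t => c * f t).
Proof.
move=> pF; apply: cprimitive_eq (cprimitiveM (cprimitive_cst c) pF) => t //=.
by rewrite mul0r add0r.
Qed.

Lemma cprimitive0_cst F : cprimitive F (fun=> 0) -> forall x y : R, F x = F y.
Proof.
by move=> [p1 p2] x y; apply: complex_eq; [exact: primitive0_cst p1 _ _|
  exact: primitive0_cst p2 _ _].
Qed.

Lemma cprimitive_opp F f : cprimitive F f ->
  cprimitive (fun t => F (- t)) (fun t => - f (- t)).
Proof.
move=> [p1 p2]; split.
  by apply: primitive_eq (primitive_opp p1) => t; rewrite ?creim.
by apply: primitive_eq (primitive_opp p2) => t; rewrite ?creim.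
Qed.

Lemma primitive_normsq F f : cprimitive F f ->
  primitive (fun t => normsq (F t))
    (fun t => 2 * (Re (F t) * Re (f t) + Im (F t) * Im (f t))).
Proof.
move=> [p1 p2].
apply: primitive_eq (primitiveD (primitiveM p1 p1) (primitiveM p2 p2)) => t.
  by rewrite /normsq !expr2.
by ring.
Qed.

Lemma cprimitive_cexp (k : C) :
  cprimitive (fun t => cexp (k * t%:C)) (fun t => k * cexp (k * t%:C)).
Proof.
pose a := Re k; pose b := Im k.
have pe : primitive (fun t => expR (a * t)) (fun t => a * expR (a * t)).
  exact: primitive_expR (primitive_linear a).
have cb : continuous (fun t : R => b * t).
  by move=> t; apply: cvgM; [exact: cvg_cst|exact: cvg_id].
have dl (t : R) : is_derive t 1 (fun t => b * t) b.
  exact: primitive_is_derive (primitive_linear b) (@cst_continuous _ _ b).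
have pc : primitive (fun t => cos (b * t)) (fun t => - b * sin (b * t)).
  apply: primitive_of_derive => t.
    apply: cvgM; first exact: cvg_cst.
    by apply: continuous_comp; [exact: cb|exact: continuous_sin].
  rewrite mulNr mulrC -mulNr; apply: is_derive1_comp.
have ps : primitive (fun t => sin (b * t)) (fun t => b * cos (b * t)).
  apply: primitive_of_derive => t.
    apply: cvgM; first exact: cvg_cst.
    by apply: continuous_comp; [exact: cb|exact: continuous_cos].
  by rewrite mulrC; apply: is_derive1_comp.
split.
  apply: primitive_eq (primitiveM pe pc) => t; rewrite /cexp !creim /= -/a -/b.
    by rewrite !mulr0 subr0 add0r mul0r subr0.
  by rewrite !mulr0 !subr0 !add0r !mul0r; ring.
apply: primitive_eq (primitiveM pe ps) => t; rewrite /cexp !creim /= -/a -/b.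
  by rewrite !mulr0 subr0 add0r mul0r addr0.
by rewrite !mulr0 !subr0 !add0r !mul0r; ring.
Qed.

(** The equation as a first-order system. Naming the derivative makes linear
    combinations and reflections of solutions immediate. *)
Definition solution_pair (V : R -> C) (l : C) mu mu' :=
  cprimitive mu mu' /\ cprimitive mu' (fun t => (V t - l) * mu t).

Lemma is_solution_pair V l mu : is_solution V l mu ->
  solution_pair V l mu (cderiv mu).
Proof.
move=> [dmu imu emu].
have p' : cprimitive (cderiv mu) (fun t => (V t - l) * mu t).
  split; split.
  - by move=> x y; have [] := imu x y.
  - by move=> x y /emu /(congr1 Re); rewrite !creim.
  - by move=> x y; have [] := imu x y.
  - by move=> x y /emu /(congr1 Im); rewrite !creim.
split => //; split.
  apply: primitive_of_derive; first exact: primitive_continuous p'.1.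
  move=> x; apply: DeriveDef; first by have [] := dmu x.
  by rewrite /= derive1E.
apply: primitive_of_derive; first exact: primitive_continuous p'.2.
move=> x; apply: DeriveDef; first by have [] := dmu x.
by rewrite /= derive1E.
Qed.

Lemma cprimitive_cderiv F f (x : R) : cprimitive F f ->
  continuous (fun t => Re (f t)) -> continuous (fun t => Im (f t)) ->
  cderivable F x /\ cderiv F x = f x.
Proof.
move=> [p1 p2] c1 c2.
have [d1 e1] := primitive_is_derive x p1 c1.
have [d2 e2] := primitive_is_derive x p2 c2.
split; first by split.
by apply: complex_eq; rewrite /= derive1E.
Qed.

Lemma solution_pair_is V l mu mu' : solution_pair V l mu mu' ->
  is_solution V l mu /\ cderiv mu = mu'.
Proof.
move=> [p p'].
have dE (x : R) : cderivable mu x /\ cderiv mu x = mu' x.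
  apply: cprimitive_cderiv p _ _; [exact: primitive_continuous p'.1|
    exact: primitive_continuous p'.2].
have e : cderiv mu = mu' by apply/funext => x; have [] := dE x.
split=> //; split.
- by move=> x; have [] := dE x.
- by move=> x y; split; [exact: p'.1.1|exact: p'.2.1].
move=> x y xy; rewrite e; apply: complex_eq; rewrite !creim /=.
  exact: p'.1.2.
exact: p'.2.2.
Qed.

End complex_calculus.

(** * The phase system and its energy estimate *)

Section energy.
Context {R : realType}.
Local Notation C := R[i].
Local Notation leb := (@lebesgue_measure R).
Local Notation Re := (@complex.Re R).
Local Notation Im := (@complex.Im R).
Local Notation normc := (@Normc.normc R).
Implicit Types (V mu phi u g : R -> C) (k l z : C).

(** The equation without its exponential factor: a solution mu gives
    phi = cexp (- k x) * mu and u = cexp (- k x) * (mu' + k * mu). In these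
    unknowns k enters linearly, and u changes only through V, so that u has a
    limit at +oo. The forcing g appears when solutions for two values of k are
    subtracted. *)
Definition phase_system V k phi u g :=
  cprimitive phi (fun t => u t - 2 * k * phi t + g t) /\
  cprimitive u (fun t => V t * phi t).

Lemma solution_phase_system V k mu mu' : solution_pair V (- k ^+ 2) mu mu' ->
  phase_system V k (fun t => cexp (- k * t%:C) * mu t)
    (fun t => cexp (- k * t%:C) * (mu' t + k * mu t)) (fun=> 0).
Proof.
move=> [p p']; have pe := cprimitive_cexp (- k).
split.
  apply: cprimitive_eq (cprimitiveM pe p) => t //=; ring.
apply: cprimitive_eq (cprimitiveM pe (cprimitiveD p' (cprimitiveZ k p))) => t //=.
ring.
Qed.

Definition inner z1 z2 : R := Re z1 * Re z2 + Im z1 * Im z2.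

Lemma inner_le z1 z2 : inner z1 z2 <= normc z1 * normc z2.
Proof.
apply: le_trans (ler_norm _) _.
rewrite -(ler_pXn2r (n := 2)) ?nnegrE ?mulr_ge0 ?normc_ge0//.
rewrite exprMn !sqr_normc real_normK ?num_real// /inner /normsq.
rewrite -subr_ge0.
have -> : (Re z1 ^+ 2 + Im z1 ^+ 2) * (Re z2 ^+ 2 + Im z2 ^+ 2) -
  (Re z1 * Re z2 + Im z1 * Im z2) ^+ 2 = (Re z1 * Im z2 - Im z1 * Re z2) ^+ 2.
  by ring.
exact: sqr_ge0.
Qed.

(** The weight d^2 on phi bounds the coupling of phi and u by d times the energy
    d^2 |phi|^2 + |u|^2, and the forcing by another such term plus d |g|^2. The
    two conditions on d say that the rate 2 c pays for both. *)
Lemma energy_rate (d c : R) k v p q w : 0 < d -> d <= c -> d <= c + 2 * Re k ->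
  d ^+ 2 * (2 * inner p (q - 2 * k * p + w)) + 2 * inner q (v * p) <=
  (2 * c + normc v / d) * (d ^+ 2 * normsq p + normsq q) + d * normsq w.
Proof.
move=> d0 dc dck.
have nq : 2 * inner q (v * p) <= normc v / d * (d ^+ 2 * normsq p + normsq q).
  have := inner_le q (v * p); rewrite Normc.normcM => h.
  have -> : normc v / d * (d ^+ 2 * normsq p + normsq q) =
      normc v * ((d ^+ 2 * normsq p + normsq q) / d) by rewrite mulrAC mulrA.
  have h2 : 2 * (normc q * normc p) <= (d ^+ 2 * normsq p + normsq q) / d.
    rewrite ler_pdivlMr// -!sqr_normc.
    have := sqr_ge0 (d * normc p - normc q); nra.
  have := ler_wpM2l (normc_ge0 v) h2; lra.
have h1 : d * (2 * inner p q) <= d ^+ 2 * normsq p + normsq q.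
  rewrite /inner /normsq.
  have := sqr_ge0 (d * Re p - Re q); have := sqr_ge0 (d * Im p - Im q); nra.
have h2 : d * (2 * inner p w) <= d ^+ 2 * normsq p + normsq w.
  rewrite /inner /normsq.
  have := sqr_ge0 (d * Re p - Re w); have := sqr_ge0 (d * Im p - Im w); nra.
have e : inner p (q - 2 * k * p + w) =
    inner p q - 2 * Re k * normsq p + inner p w.
  by rewrite /inner /normsq !creim /=; ring.
rewrite e.
have h1' := ler_wpM2l (ltW d0) h1; have h2' := ler_wpM2l (ltW d0) h2.
have P0 := normsq_ge0 p; have Q0 := normsq_ge0 q.
have P1 : 0 <= d ^+ 2 * normsq p by rewrite mulr_ge0// sqr_ge0.
have h3 : 0 <= (c + 2 * Re k - d) * (d ^+ 2 * normsq p).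
  by rewrite mulr_ge0// subr_ge0.
have h4 : 0 <= (c - d) * normsq q by rewrite mulr_ge0// subr_ge0.
have h5 : 0 <= d * normsq q by rewrite mulr_ge0// ltW.
move: nq h1' h2' h3 h4 h5.
rewrite [(2 * c + _) * _]mulrDl.
set n := normc v / d * _; set A := inner p q; set B := inner p w.
set P := normsq p; set Q := normsq q; set W := normsq w; set r := Re k.
move=> nq h1' h2' h3 h4 h5.
have {}h1' : d ^+ 2 * (2 * A) <= d * (d ^+ 2 * P + Q) by rewrite expr2 -mulrA.
have {}h2' : d ^+ 2 * (2 * B) <= d * (d ^+ 2 * P + W) by rewrite expr2 -mulrA.
lra.
Qed.

(** Gronwall: the energy times expR (- 2 c x - (K x - K 0) / d), plus an
    explicit function whose derivative cancels the forcing, is nonincreasing. *)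
Lemma energy_bound V k phi u g K (L c c' d M : R) :
  phase_system V k phi u g -> primitive K (fun t => normc (V t)) ->
  (forall x, 0 <= x -> K x - K 0 <= L) ->
  0 < d -> d <= c -> d <= c + 2 * Re k -> c' < c -> 0 <= M ->
  (forall t, 0 <= t -> normsq (g t) <= M * expR (2 * c' * t)) ->
  forall x, 0 <= x ->
  d ^+ 2 * normsq (phi x) + normsq (u x) <=
  expR (L / d) * (d ^+ 2 * normsq (phi 0) + normsq (u 0) + d * M / (2 * (c - c'))) *
  expR (2 * c * x).
Proof.
move=> [pphi pu] pK KL d0 dc dck cc' M0 gM x x0.
have incK y : 0 <= y -> K 0 <= K y.
  move=> y0; rewrite -subr_ge0 pK.2// Rintegral_ge0// => t _; exact: normc_ge0.
pose S t := d ^+ 2 * normsq (phi t) + normsq (u t).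
have S0 t : 0 <= S t.
  by rewrite addr_ge0 ?normsq_ge0// mulr_ge0 ?normsq_ge0 ?sqr_ge0.
have pS := primitiveD (primitiveZ (d ^+ 2) (primitive_normsq pphi))
  (primitive_normsq pu).
pose S' t := d ^+ 2 * (2 * inner (phi t) (u t - 2 * k * phi t + g t)) +
  2 * inner (u t) (V t * phi t).
have {}pS : primitive S S' by [].
pose w t := expR ((- (2 * c)) * t + (- d^-1) * (K t + - K 0)).
have pw := primitive_expR (primitiveD (primitive_linear (- (2 * c)))
  (primitiveZ (- d^-1) (primitiveD pK (primitive_cst (- K 0))))).
have {}pw : primitive w (fun t => (- (2 * c) + (- d^-1) * (normc (V t) + 0)) * w t).
  by [].
pose N := d * M / (2 * (c - c')).
have cc0 : 0 < 2 * (c - c') by lra.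
have N0 : 0 <= N.
  by rewrite divr_ge0 ?(ltW cc0)// mulr_ge0// ltW.
pose H t := N * expR ((- (2 * (c - c'))) * t).
have pH : primitive H (fun t => N * ((- (2 * (c - c'))) * expR ((- (2 * (c - c'))) * t))).
  exact: primitiveZ (primitive_expR (primitive_linear _)).
have pZ := primitiveD (primitiveM pS pw) pH.
have := primitive_le pZ x0.
have w0 t : 0 <= w t by exact: expR_ge0.
have H0 t : 0 <= H t by rewrite mulr_ge0// expR_ge0.
move=> /(_ _)/wrap[|Zle].
  move=> t /andP[t0 _].
  have NE : N * (2 * (c - c')) = d * M.
    by rewrite /N -mulrA mulVf ?mulr1// gt_eqF.
  have -> : N * (- (2 * (c - c')) * expR (- (2 * (c - c')) * t)) =
      - (d * M * expR (- (2 * (c - c')) * t)) by rewrite -NE; ring.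
  have rate := @energy_rate d c k (V t) (phi t) (u t) (g t) d0 dc dck.
  rewrite -/(S' t) -/(S t) in rate.
  have -> : S' t * w t + S t * ((- (2 * c) + - d^-1 * (normc (V t) + 0)) * w t) =
    (S' t - (2 * c + normc (V t) / d) * S t) * w t by ring.
  have step1 : (S' t - (2 * c + normc (V t) / d) * S t) * w t <=
      d * M * expR (2 * c' * t) * w t.
    apply: ler_wpM2r => //; rewrite lerBlDl; apply: le_trans rate _.
    rewrite lerD2l -mulrA; apply: ler_wpM2l; [exact: ltW|exact: gM].
  have step2 : w t <= expR (- (2 * c) * t).
    rewrite /w ler_expR mulNr gerDl mulNr oppr_le0 mulr_ge0 ?invr_ge0 ?(ltW d0)//.
    by rewrite subr_ge0 incK.
  have dM0 : 0 <= d * M * expR (2 * c' * t).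
    by rewrite !mulr_ge0 ?expR_ge0// ltW.
  have step3 := ler_wpM2l dM0 step2.
  have e : d * M * expR (2 * c' * t) * expR (- (2 * c) * t) =
      d * M * expR (- (2 * (c - c')) * t).
    by rewrite -mulrA -expRD; congr (_ * expR _); ring.
  rewrite e in step3; lra.
have Z0E : S 0 * w 0 + H 0 = S 0 + N.
  by rewrite /w /H !mulr0 subrr mulr0 addr0 expR0 !mulr1.
rewrite Z0E in Zle.
have Sw : S x * w x <= S 0 + N by have := H0 x; lra.
have wE : 1 <= w x * (expR (L / d) * expR (2 * c * x)).
  rewrite /w -!expRD -[leLHS]expR0 ler_expR.
  have : 0 <= (L - (K x - K 0)) / d by rewrite divr_ge0 ?(ltW d0)// subr_ge0 KL.
  set D := d^-1; lra.
have F0 : 0 <= expR (L / d) * expR (2 * c * x) by rewrite mulr_ge0 ?expR_ge0.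
have h1 := ler_wpM2l (S0 x) wE; have h2 := ler_wpM2r F0 Sw.
rewrite mulr1 in h1; apply: (le_trans h1).
by rewrite [leLHS]mulrA; apply: (le_trans h2); rewrite /S -/N; lra.
Qed.

End energy.

(** * Decay of the potential and complex integrals *)

Section decay.
Context {R : realType}.
Local Notation C := R[i].
Local Notation leb := (@lebesgue_measure R).
Local Notation Re := (@complex.Re R).
Local Notation Im := (@complex.Im R).
Local Notation normc := (@Normc.normc R).
Implicit Types (V mu phi u g f F : R -> C) (k l z : C).

Definition cmeasurable f :=
  measurable_fun [set: R] (fun t => Re (f t)) /\
  measurable_fun [set: R] (fun t => Im (f t)).

Lemma cmeasurableM f g : cmeasurable f -> cmeasurable g ->
  cmeasurable (fun t => f t * g t).
Proof.
move=> [f1 f2] [g1 g2]; split.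
  apply: (eq_measurable_fun (fun t => Re (f t) * Re (g t) - Im (f t) * Im (g t))).
    by move=> t _; rewrite !creim.
  by apply: measurable_funB; exact: measurable_funM.
apply: (eq_measurable_fun (fun t => Re (f t) * Im (g t) + Im (f t) * Re (g t))).
  by move=> t _; rewrite !creim.
by apply: measurable_funD; exact: measurable_funM.
Qed.

Lemma cmeasurable_cprimitive F f : cprimitive F f -> cmeasurable F.
Proof.
move=> [p1 p2]; split; apply: continuous_measurable_fun.
  exact: primitive_continuous p1.
exact: primitive_continuous p2.
Qed.

Lemma measurable_normsq f : cmeasurable f ->
  measurable_fun [set: R] (fun t => normsq (f t)).
Proof. by move=> [f1 f2]; apply: measurable_funD; exact: measurable_funX. Qed.

Lemma measurable_normc f : cmeasurable f ->
  measurable_fun [set: R] (fun t => normc (f t)).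
Proof.
move=> /measurable_normsq mf.
apply: (eq_measurable_fun (fun t => Num.sqrt (normsq (f t)))).
  by move=> t _; rewrite normcE.
apply: measurableT_comp mf.
by apply: continuous_measurable_fun; exact: sqrt_continuous.
Qed.

(** The decay of V in the form that the estimates consume: by Cauchy-Schwarz a
    weighted L2 bound at the rate 2 a is a weighted L1 bound at any lower rate. *)
Definition exp_decay (a : R) V := cmeasurable V /\ forall c, c < 2 * a ->
  leb.-integrable setT (EFin \o (fun x => expR (c * `|x|) * normc (V x))).

Lemma integrable_sub (D : set (measurableTypeR R)) (f : R -> R) : measurable D ->
  leb.-integrable setT (EFin \o f) -> leb.-integrable D (EFin \o f).
Proof. by move=> mD; apply: integrableS. Qed.

Lemma cintegrable_dominated (D : set (measurableTypeR R)) f (g : R -> R) :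
  measurable D -> cmeasurable f -> leb.-integrable D (EFin \o g) ->
  (forall x, D x -> normc (f x) <= g x) -> cintegrable D f.
Proof.
move=> mD [m1 m2] ig fg; split.
  apply: (integrable_dominated mD _ ig); first exact: measurable_funTS.
  by move=> x Dx; apply: le_trans (fg x Dx); exact: le_Re_normc.
apply: (integrable_dominated mD _ ig); first exact: measurable_funTS.
by move=> x Dx; apply: le_trans (fg x Dx); exact: le_Im_normc.
Qed.

Lemma normc_cintegral_le (D : set (measurableTypeR R)) f (g : R -> R) :
  measurable D -> cmeasurable f -> leb.-integrable D (EFin \o g) ->
  (forall x, D x -> normc (f x) <= g x) ->
  normc (cintegral D f) <= 2 * \int[leb]_(x in D) g x.
Proof.
(* The factor 2 comes from bounding the real and imaginary parts separately. *)
move=> mD mf ig fg; have [i1 i2] := cintegrable_dominated mD mf ig fg.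
apply: le_trans (normc_le_ReIm _) _; rewrite mulr_natl mulr2n; apply: lerD => /=.
  apply: le_trans (le_normr_Rintegral mD i1) _.
  apply: le_Rintegral => //; first exact: integrable_norm i1.
  by move=> x Dx; apply: le_trans (fg x Dx); exact: le_Re_normc.
apply: le_trans (le_normr_Rintegral mD i2) _.
apply: le_Rintegral => //; first exact: integrable_norm i2.
by move=> x Dx; apply: le_trans (fg x Dx); exact: le_Im_normc.
Qed.

Lemma integrableZ_real (D : set (measurableTypeR R)) (r : R) (f : R -> R) :
  measurable D -> leb.-integrable D (EFin \o f) ->
  leb.-integrable D (EFin \o (fun x => r * f x)).
Proof.
move=> mD i; rewrite (_ : _ \o _ = (fun x => r%:E * (EFin \o f) x)%E);
  [exact: integrableZl|exact/funext].
Qed.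

Lemma integrableD_real (D : set (measurableTypeR R)) (f g : R -> R) :
  measurable D -> leb.-integrable D (EFin \o f) -> leb.-integrable D (EFin \o g) ->
  leb.-integrable D (EFin \o (fun x => f x + g x)).
Proof.
move=> mD i j; rewrite (_ : _ \o _ = (EFin \o f) \+ (EFin \o g))%E;
  [exact: integrableD|exact/funext].
Qed.

Lemma cintegrableZ (D : set (measurableTypeR R)) f z : measurable D -> cintegrable D f ->
  cintegrable D (fun t => z * f t) /\
  cintegral D (fun t => z * f t) = z * cintegral D f.
Proof.
move=> mD [i1 i2].
have j1 := integrableZ_real (Re z) mD i1; have j2 := integrableZ_real (- Im z) mD i2.
have j3 := integrableZ_real (Re z) mD i2; have j4 := integrableZ_real (Im z) mD i1.
have e1 : (fun t => Re (z * f t)) = (fun t => Re z * Re (f t) + - Im z * Im (f t)).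
  by apply/funext => t; rewrite !creim; ring.
have e2 : (fun t => Im (z * f t)) = (fun t => Re z * Im (f t) + Im z * Re (f t)).
  by apply/funext => t; rewrite !creim; ring.
split.
  split.
    by have := integrableD_real mD j1 j2; rewrite -e1.
  by have := integrableD_real mD j3 j4; rewrite -e2.
apply: complex_eq; rewrite creim /=.
  by rewrite e1 RintegralD// !RintegralZl//; ring.
by rewrite e2 RintegralD// !RintegralZl//.
Qed.

Lemma cintegrableD (D : set (measurableTypeR R)) f g : measurable D ->
  cintegrable D f -> cintegrable D g ->
  cintegrable D (fun t => f t + g t) /\
  cintegral D (fun t => f t + g t) = cintegral D f + cintegral D g.
Proof.
move=> mD [i1 i2] [j1 j2].
have e1 : (fun t => Re (f t + g t)) = (fun t => Re (f t) + Re (g t)).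
  by apply/funext => t; rewrite !creim.
have e2 : (fun t => Im (f t + g t)) = (fun t => Im (f t) + Im (g t)).
  by apply/funext => t; rewrite !creim.
split.
  split.
    by have := integrableD_real mD i1 j1; rewrite -e1.
  by have := integrableD_real mD i2 j2; rewrite -e2.
apply: complex_eq; rewrite creim /=.
  by rewrite e1 RintegralD.
by rewrite e2 RintegralD.
Qed.

Lemma cintegral_ray F f (x : R) : cprimitive F f -> cintegrable `[0, +oo[ f ->
  cintegrable `[x, +oo[ f /\
  cintegral `[x, +oo[ f = cintegral `[0, +oo[ f - (F x - F 0).
Proof.
move=> [p1 p2] [i1 i2].
have [j1 e1] := integral_ray x p1 i1; have [j2 e2] := integral_ray x p2 i2.
by split=> //; apply: complex_eq; rewrite !creim /=.
Qed.

Lemma cintegral_opp_ray f (x : R) : cintegrable `[- x, +oo[ (fun t => f (- t)) ->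
  cintegrable `]-oo, x] f /\
  cintegral `]-oo, x] f = cintegral `[- x, +oo[ (fun t => f (- t)).
Proof.
have pre : -%R @^-1` `[- x, +oo[ = `]-oo, x]%classic :> set (measurableTypeR R).
  by rewrite opp_preimage_itvbndy opprK.
move=> [i1 i2].
have [j1 e1] := integrable_opp_on (measurable_itv _) i1.
have [j2 e2] := integrable_opp_on (measurable_itv _) i2.
rewrite pre in j1 e1 j2 e2.
have o (h : R -> R) : (fun t => h (- - t)) = h by apply/funext => t; rewrite opprK.
rewrite (o (fun t => Re (f t))) in j1 e1; rewrite (o (fun t => Im (f t))) in j2 e2.
by split; [split|rewrite /cintegral -e1 -e2].
Qed.

Lemma exp_decay_opp a V : exp_decay a V -> exp_decay a (fun t => V (- t)).
Proof.
move=> [[m1 m2] iV]; split.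
  have mN : measurable_fun setT (-%R : R -> R) by exact: oppr_measurable.
  by split; [exact: (measurableT_comp m1 mN)|exact: (measurableT_comp m2 mN)].
move=> c ca; have [+ _] := integrable_opp (iV c ca).
by under eq_fun do rewrite normrN.
Qed.

Lemma exp_decay_of_L2 a V : 0 < a ->
  in_L2 (fun=> 1) (fun x => (expR (2 * a * `|x|))%:C * V x) -> exp_decay a V.
Proof.
move=> a0 [m1 m2 fin].
have cE (c : R) : continuous (fun x : R => expR (c * `|x|)).
  move=> x; apply: continuous_comp; last exact: continuous_expR.
  by apply: cvgM; [exact: cvg_cst|exact: norm_continuous].
have mE (c : R) : measurable_fun [set: R] (fun x : R => expR (c * `|x|)).
  by apply: continuous_measurable_fun; exact: cE.
pose W x := (expR (2 * a * `|x|))%:C * V x.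
have mW : cmeasurable W by [].
have VE x : V x = (expR (- (2 * a) * `|x|))%:C * W x.
  by rewrite /W mulrA -rmorphM/= -expRD mulNr addNr expR0 mul1r.
have mV : cmeasurable V.
  rewrite (_ : V = fun x => (expR (- (2 * a) * `|x|))%:C * W x); last exact/funext.
  apply: cmeasurableM => //; split => /=; first exact: mE.
  exact: measurable_cst.
split=> // c ca.
have iW : leb.-integrable setT (EFin \o (fun x => normc (W x) ^+ 2)).
  apply/integrableP; split.
    apply/measurable_EFinP; apply: measurable_funX; exact: measurable_normc.
  apply: le_lt_trans fin; rewrite le_eqVlt; apply/orP; left; apply/eqP.
  by apply: eq_integral => x _ /=; rewrite mul1r ger0_norm// sqr_ge0.
have iE : leb.-integrable setT (EFin \o (fun x => expR (- (2 * (2 * a - c) * `|x|)))).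
  by apply: integrable_expR_abs; lra.
apply: (integrable_dominated _ _ (integrableD_real _ iW iE)) => //.
  by apply: measurable_funM; [exact: mE|exact: measurable_normc].
move=> x _.
have -> : expR (- (2 * (2 * a - c) * `|x|)) = expR (- (2 * a - c) * `|x|) ^+ 2.
  by rewrite expr2 -expRD; congr expR; ring.
rewrite VE Normc.normcM.
have -> : normc (expR (- (2 * a) * `|x|))%:C = expR (- (2 * a) * `|x|).
  by rewrite normcE /normsq !creim expr0n/= addr0 sqrtr_sqr ger0_norm ?expR_ge0.
rewrite mulrA -expRD -mulrDl.
have -> : c + - (2 * a) = - (2 * a - c) by ring.
have := normc_ge0 (W x); have := expR_ge0 (- (2 * a - c) * `|x|).
set p := expR _; set q := normc _ => p0 q0.
rewrite ger0_norm ?mulr_ge0//.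
have := sqr_ge0 (p - q); have := sqr_ge0 (p + q); nra.
Qed.

Lemma exp_decay_L1 a V : 0 < a -> exp_decay a V ->
  exists K : R -> R, exists L : R, [/\ 0 <= L, primitive K (fun t => normc (V t)) &
    forall x, 0 <= x -> K x - K 0 <= L].
Proof.
move=> a0 [mV iV].
have i : leb.-integrable setT (EFin \o (fun x => normc (V x))).
  have := iV 0; rewrite mulr_gt0// => /(_ isT).
  by under eq_fun do rewrite mul0r expR0 mul1r.
have l : locint (fun x => normc (V x)) by move=> x y; exact: integrable_sub.
have [K pK] := locint_primitive l.
exists K, (\int[leb]_x normc (V x)); split => //.
  by apply: Rintegral_ge0 => x _; exact: normc_ge0.
move=> x x0; rewrite pK.2// /Rintegral fine_le//.
- by apply: integrable_fin_num => //; exact: l.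
- exact: integrable_fin_num.
- apply: ge0_subset_integral => //.
    by apply/measurable_EFinP; exact: measurable_normc.
  by move=> t _; rewrite lee_fin normc_ge0.
Qed.

End decay.

(** * Growth of solutions and the coefficient at +oo *)

Section growth.
Context {R : realType}.
Local Notation C := R[i].
Local Notation leb := (@lebesgue_measure R).
Local Notation Re := (@complex.Re R).
Local Notation Im := (@complex.Im R).
Local Notation normc := (@Normc.normc R).
Implicit Types (V mu phi u g f F : R -> C) (k l z : C).

(** The constant B depends on d and V only, so that it serves all k close to a
    given one; the expansion in k rests on this uniformity. *)
Lemma phase_growth a V (d : R) : 0 < a -> exp_decay a V -> 0 < d ->
  exists2 B : R, 0 <= B & forall k phi u g (c c' M : R),
    phase_system V k phi u g -> d <= c -> d <= c + 2 * Re k -> c' < c -> 0 <= M ->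
    (forall t, 0 <= t -> normsq (g t) <= M * expR (2 * c' * t)) ->
    forall x, 0 <= x -> normsq (phi x) <=
      B * (normsq (phi 0) + normsq (u 0) + M / (c - c')) * expR (2 * c * x).
Proof.
move=> a0 dV d0; have [K [L [L0 pK KL]]] := exp_decay_L1 a0 dV.
pose q := 1 + d^-1 ^+ 2 + d^-1.
have i0 : 0 < d^-1 by rewrite invr_gt0.
exists (expR (L / d) * q).
  by rewrite mulr_ge0 ?expR_ge0// !addr_ge0 ?sqr_ge0// ltW.
move=> k phi u g c c' M ps dc dck cc' M0 gM x x0.
have := energy_bound ps pK KL d0 dc dck cc' M0 gM x0.
set E := expR (L / d); set X := expR (2 * c * x).
have P0 := normsq_ge0 (phi 0); have U0 := normsq_ge0 (u 0).
set P := normsq (phi 0); set U := normsq (u 0).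
have cc0 : 0 < c - c' by rewrite subr_gt0.
pose N := M / (c - c'); have N0 : 0 <= N by rewrite divr_ge0 ?(ltW cc0).
have -> : d * M / (2 * (c - c')) = d * N / 2 by rewrite /N invfM; ring.
move=> h.
have Ux := normsq_ge0 (u x).
have {h Ux} h : d ^+ 2 * normsq (phi x) <= E * (d ^+ 2 * P + U + d * N / 2) * X by lra.
have {h} h : normsq (phi x) <= d^-1 ^+ 2 * (E * (d ^+ 2 * P + U + d * N / 2) * X).
  have := ler_wpM2l (sqr_ge0 d^-1) h.
  by rewrite mulrA -exprMn mulVf ?gt_eqF// expr1n mul1r.
apply: (le_trans h).
have -> : d^-1 ^+ 2 * (E * (d ^+ 2 * P + U + d * N / 2) * X) =
   E * ((d^-1 * d) ^+ 2 * P + d^-1 ^+ 2 * U + (d^-1 * d) * d^-1 * N / 2) * X by ring.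
rewrite mulVf ?gt_eqF// expr1n !mul1r.
apply: ler_wpM2r; first exact: expR_ge0.
rewrite -[leRHS]mulrA; apply: ler_wpM2l; first exact: expR_ge0.
have s0 : 0 <= d^-1 ^+ 2 by exact: sqr_ge0.
rewrite -/N /q; set s := d^-1 ^+ 2; set i := d^-1.
have a1 : 0 <= s * P by rewrite mulr_ge0.
have a2 : 0 <= i * P by rewrite mulr_ge0// ltW.
have a3 : 0 <= i * U by rewrite mulr_ge0// ltW.
have a4 : 0 <= s * N by rewrite mulr_ge0.
have a5 : 0 <= i * N by rewrite mulr_ge0// ltW.
rewrite -/s in s0; rewrite -/P in P0; rewrite -/U in U0; lra.
Qed.

Lemma solution_growth a V k mu mu' (c : R) : 0 < a -> exp_decay a V ->
  solution_pair V (- k ^+ 2) mu mu' -> 0 < c -> 0 < c + 2 * Re k ->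
  exists2 B : R, 0 <= B & forall x, 0 <= x ->
    normc (cexp (- k * x%:C) * mu x) <= B * expR (c * x).
Proof.
move=> a0 dV sol c0 ck0.
pose d := Num.min c (c + 2 * Re k).
have d0 : 0 < d by rewrite lt_min c0.
have [B B0 hB] := phase_growth a0 dV d0.
have ps := solution_phase_system sol.
set phi := (fun t => cexp (- k * t%:C) * mu t) in ps.
set u := (fun t => cexp (- k * t%:C) * (mu' t + _)) in ps.
pose A := normsq (phi 0) + normsq (u 0) + 0 / (c - (c - 1)).
have A0 : 0 <= A by rewrite /A mul0r addr0 addr_ge0// normsq_ge0.
exists (Num.sqrt (B * A)); first exact: sqrtr_ge0.
move=> x x0; rewrite -/(phi x).
rewrite -(ler_pXn2r (n := 2)) ?nnegrE ?mulr_ge0 ?normc_ge0 ?sqrtr_ge0 ?expR_ge0//.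
rewrite sqr_normc exprMn sqr_sqrtr ?mulr_ge0//.
have -> : expR (c * x) ^+ 2 = expR (2 * c * x).
  by rewrite expr2 -expRD; congr expR; ring.
apply: hB ps _ _ _ _ _ _ x0 => //.
- by rewrite /d ge_min lexx.
- by rewrite /d ge_min lexx orbT.
- by rewrite ltrBlDr ltrDl.
- by move=> t t0; rewrite /normsq /= expr0n/= addr0 mul0r.
Qed.

Definition tail_mass V (c : R) : R :=
  \int[leb]_(t in `[0, +oo[) (expR (c * `|t|) * normc (V t)).

Lemma tail_mass_ge0 V c : 0 <= tail_mass V c.
Proof.
by apply: Rintegral_ge0 => t _; rewrite mulr_ge0 ?expR_ge0 ?normc_ge0.
Qed.

Lemma tail_integral a V phi (B c : R) : exp_decay a V -> c < 2 * a ->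
  cmeasurable phi ->
  (forall x, 0 <= x -> normc (phi x) <= B * expR (c * x)) ->
  cintegrable `[0, +oo[ (fun y => V y * phi y) /\
  normc (cintegral `[0, +oo[ (fun y => V y * phi y)) <= 2 * B * tail_mass V c.
Proof.
move=> [mV iV] ca mphi hB.
have i := integrable_sub (measurable_itv `[(0 : R), +oo[) (iV c ca).
have iB := integrableZ_real B (measurable_itv `[(0 : R), +oo[) i.
have mVp := cmeasurableM mV mphi.
have dom x : `[0, +oo[%classic x ->
    normc (V x * phi x) <= B * (expR (c * `|x|) * normc (V x)).
  rewrite /= in_itv/= andbT => x0; rewrite Normc.normcM mulrA mulrC.
  by apply: ler_wpM2r; [exact: normc_ge0|rewrite ger0_norm//; exact: hB].
split; first exact: cintegrable_dominated iB dom.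
apply: le_trans (normc_cintegral_le _ mVp iB dom) _ => //.
by rewrite RintegralZl// mulrA.
Qed.

(** For a solution, the limit at +oo of cexp (- k x) * (mu' x + k * mu x), written
    as the value at 0 plus the integral of the derivative. *)
Definition plus_coef V k mu mu' : C :=
  mu' 0 + k * mu 0 +
  cintegral `[0, +oo[ (fun y => V y * (cexp (- k * y%:C) * mu y)).

Lemma tail_solution a V k mu mu' : 0 < a -> exp_decay a V -> - a < Re k ->
  solution_pair V (- k ^+ 2) mu mu' ->
  cintegrable `[0, +oo[ (fun y => V y * (cexp (- k * y%:C) * mu y)).
Proof.
move=> a0 dV ka sol.
(* phi grows at most at any rate above m, and V decays at the rate 2 a; c lies
   halfway. *)
pose m := Num.max 0 (- (2 * Re k)); pose c := (m + 2 * a) / 2.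
have m0 : 0 <= m by rewrite le_max lexx.
have mk : - (2 * Re k) <= m by rewrite le_max lexx orbT.
have ma : m < 2 * a by rewrite gt_max mulr_gt0//=; lra.
have c0 : 0 < c by rewrite /c; lra.
have ck : 0 < c + 2 * Re k by rewrite /c; lra.
have ca : c < 2 * a by rewrite /c; lra.
have [B _ hB] := solution_growth a0 dV sol c0 ck.
have [pphi _] := solution_phase_system sol.
by have [] := tail_integral dV ca (cmeasurable_cprimitive pphi) hB.
Qed.

(** Since V * mu is mu'' - k^2 * mu, the integrand is the derivative of
    cexp (- k (y - x)) * (mu' y + k * mu y). *)
Lemma ray_solution a V k mu mu' (x : R) : 0 < a -> exp_decay a V -> - a < Re k ->
  solution_pair V (- k ^+ 2) mu mu' ->
  cintegral `[x, +oo[ (fun y => cexp (- k * (y - x)%:C) * V y * mu y) =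
  cexp (k * x%:C) * plus_coef V k mu mu' - (mu' x + k * mu x).
Proof.
move=> a0 dV ka sol; have ti := tail_solution a0 dV ka sol.
have [_ pu] := solution_phase_system sol.
have [ix ex] := cintegral_ray x pu ti.
have e1 : (fun y => cexp (- k * (y - x)%:C) * V y * mu y) =
    (fun y => cexp (k * x%:C) * (V y * (cexp (- k * y%:C) * mu y))).
  apply/funext => y.
  have -> : - k * (y - x)%:C = k * x%:C + - k * y%:C by rewrite rmorphB/=; ring.
  by rewrite cexpD; ring.
rewrite e1; have [_ ->] := cintegrableZ (cexp (k * x%:C)) (measurable_itv _) ix.
rewrite ex /plus_coef mulr0 cexp0 mul1r.
have := cexpN (k * x%:C); rewrite -mulNr.
set X := cexp _; set Y := cexp _ => YX.
set I := cintegral _ _.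
transitivity (Y * (mu' 0 + k * mu 0 + I) - (X * Y) * (mu' x + k * mu x)); first by ring.
by rewrite YX mul1r.
Qed.

End growth.

(** * The functions D and DD in terms of the coefficients *)

Section formula.
Context {R : realType}.
Local Notation C := R[i].
Local Notation leb := (@lebesgue_measure R).
Local Notation Re := (@complex.Re R).
Local Notation Im := (@complex.Im R).
Local Notation normc := (@Normc.normc R).
Implicit Types (V mu phi u g f F : R -> C) (k l z s : C).

Lemma solution_pair_opp V l mu mu' : solution_pair V l mu mu' ->
  solution_pair (fun t => V (- t)) l (fun t => mu (- t)) (fun t => - mu' (- t)).
Proof.
move=> [p p']; split; first exact: cprimitive_opp.
by apply: cprimitive_eq (cprimitiveN (cprimitive_opp p')) => t //=; rewrite opprK.
Qed.

(** The left half-line is the right one of the reflected potential. For a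
    solution the value is minus the limit at -oo of cexp (k x) * (mu' x - k * mu x). *)
Definition minus_coef V k mu mu' : C :=
  plus_coef (fun t => V (- t)) k (fun t => mu (- t)) (fun t => - mu' (- t)).

Lemma lamE s : lam s = - (sqrtN s) ^+ 2.
Proof. by rewrite /lam /sqrtN exprMn sqr_i; ring. Qed.

Lemma Re_sqrtN s : Re (sqrtN s) = - Im s.
Proof. by rewrite /sqrtN; case: s => x y /=; rewrite mul0r mul1r sub0r. Qed.

Lemma sqrtN_neq0 s : s != 0 -> sqrtN s != 0.
Proof.
move=> s0; rewrite /sqrtN mulf_neq0//.
by apply/negP => /eqP /(congr1 Im) /eqP; rewrite /= oner_eq0.
Qed.

Lemma left_ray_solution a V k mu mu' (x : R) : 0 < a -> exp_decay a V -> - a < Re k ->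
  solution_pair V (- k ^+ 2) mu mu' ->
  cintegral `]-oo, x] (fun y => cexp (k * (y - x)%:C) * V y * mu y) =
  cexp (- k * x%:C) * minus_coef V k mu mu' - (- mu' x + k * mu x).
Proof.
move=> a0 dV ka sol.
have dV' := exp_decay_opp dV; have sol' := solution_pair_opp sol.
have e := ray_solution (- x) a0 dV' ka sol'.
have eq : (fun t => cexp (k * (- t - x)%:C) * V (- t) * mu (- t)) =
   (fun y => cexp (- k * (y - - x)%:C) * V (- y) * mu (- y)).
  by apply/funext => t; congr (cexp _ * _ * _); apply: complex_eq; rewrite !creim; ring.
have [|_] := @cintegral_opp_ray R (fun y => cexp (k * (y - x)%:C) * V y * mu y) x.
  rewrite eq.
  have [_ pu] := solution_phase_system sol'.
  have [ix _] := cintegral_ray (- x) pu (tail_solution a0 dV' ka sol').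
  have [j _] := cintegrableZ (cexp (k * (- x)%:C)) (measurable_itv `[- x, +oo[) ix.
  have -> : (fun y => cexp (- k * (y - - x)%:C) * V (- y) * mu (- y)) =
    (fun t => cexp (k * (- x)%:C) * (V (- t) * (cexp (- k * t%:C) * mu (- t)))).
    apply/funext => y.
    have -> : - k * (y - - x)%:C = k * (- x)%:C + - k * y%:C.
      by apply: complex_eq; rewrite !creim; ring.
    by rewrite cexpD; ring.
  exact: j.
move=> ->; rewrite eq e opprK /minus_coef.
by congr (cexp _ * _ - _); apply: complex_eq; rewrite !creim; ring.
Qed.

(** The boundary terms of the two integrals at x add up to - mu x and cancel the
    first term of D: what is left are the two free exponentials. *)
Lemma D_solution a V s mu mu' : 0 < a -> exp_decay a V -> s != 0 -> Im s < a ->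
  solution_pair V (lam s) mu mu' ->
  D V s mu = fun x => (2 * sqrtN s)^-1 *
    (cexp (sqrtN s * x%:C) * plus_coef V (sqrtN s) mu mu' +
     cexp (- sqrtN s * x%:C) * minus_coef V (sqrtN s) mu mu').
Proof.
move=> a0 dV s0 sa; rewrite lamE => sol; apply/funext => x.
have ka : - a < Re (sqrtN s) by rewrite Re_sqrtN ltrN2.
rewrite /D /green_right /green_left.
rewrite (ray_solution x a0 dV ka sol) (left_ray_solution x a0 dV ka sol).
have k0 := sqrtN_neq0 s0; set k := sqrtN s in k0 *.
have k2 : 2 * k != 0 by rewrite mulf_neq0// pnatr_eq0.
by field; rewrite k0.
Qed.

Lemma cderiv_D_solution a V s mu mu' : 0 < a -> exp_decay a V -> s != 0 -> Im s < a ->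
  solution_pair V (lam s) mu mu' ->
  cderiv (D V s mu) = fun x => 2^-1 *
    (cexp (sqrtN s * x%:C) * plus_coef V (sqrtN s) mu mu' -
     cexp (- sqrtN s * x%:C) * minus_coef V (sqrtN s) mu mu').
Proof.
move=> a0 dV s0 sa sol; rewrite (D_solution a0 dV s0 sa sol); apply/funext => x.
have k0 := sqrtN_neq0 s0; set k := sqrtN s in k0 *.
set p := plus_coef _ _ _ _; set q := minus_coef _ _ _ _.
have pE (c : C) : cprimitive (fun t => c * cexp (k * t%:C)) (fun t => c * (k * cexp (k * t%:C))).
  exact: cprimitiveZ (cprimitive_cexp k).
have pN (c : C) : cprimitive (fun t => c * cexp (- k * t%:C))
    (fun t => c * (- k * cexp (- k * t%:C))).
  exact: cprimitiveZ (cprimitive_cexp (- k)).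
have p1 : cprimitive (fun x => (2 * k)^-1 * (cexp (k * x%:C) * p + cexp (- k * x%:C) * q))
    (fun x => 2^-1 * (cexp (k * x%:C) * p - cexp (- k * x%:C) * q)).
  apply: cprimitive_eq (cprimitiveZ ((2 * k)^-1) (cprimitiveD (pE p) (pN q))) => t /=.
    by ring.
  by field; rewrite k0.
have p2 := cprimitiveZ 2^-1 (cprimitiveB (pE p) (pN q)).
have {}p2 : cprimitive (fun x => 2^-1 * (cexp (k * x%:C) * p - cexp (- k * x%:C) * q))
  (fun t => 2^-1 * (p * (k * cexp (k * t%:C)) - q * (- k * cexp (- k * t%:C)))).
  apply: cprimitive_eq p2 => t //=; ring.
have [] := @cprimitive_cderiv R _ _ x p1 _ _ => //.
  exact: primitive_continuous p2.1.
exact: primitive_continuous p2.2.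
Qed.

(** A Wronskian of combinations of the two free exponentials, hence free of x. *)
Lemma DD_solution a V s mu1 mu1' mu2 mu2' x : 0 < a -> exp_decay a V ->
  s != 0 -> Im s < a ->
  solution_pair V (lam s) mu1 mu1' -> solution_pair V (lam s) mu2 mu2' ->
  DD V s mu1 mu2 x = (2 * sqrtN s)^-1 *
    (minus_coef V (sqrtN s) mu1 mu1' * plus_coef V (sqrtN s) mu2 mu2' -
     plus_coef V (sqrtN s) mu1 mu1' * minus_coef V (sqrtN s) mu2 mu2').
Proof.
move=> a0 dV s0 sa sol1 sol2.
rewrite /DD (expand_det_row _ ord0) big_ord_recl big_ord1 /cofactor !det_mx11 !mxE /=.
rewrite (cderiv_D_solution a0 dV s0 sa sol1) (cderiv_D_solution a0 dV s0 sa sol2).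
rewrite (D_solution a0 dV s0 sa sol1) (D_solution a0 dV s0 sa sol2).
have k0 := sqrtN_neq0 s0; set k := sqrtN s in k0 *.
set p1 := plus_coef _ _ _ _; set q1 := minus_coef _ _ _ _.
set p2 := plus_coef _ _ _ _; set q2 := minus_coef _ _ _ _.
rewrite /bump /= !addn0 expr0 expr1.
have := cexpN (k * x%:C); rewrite -mulNr.
set E := cexp (k * _); set F := cexp (- k * _) => FE.
transitivity ((2 * k)^-1 * ((F * E) * (q1 * p2 - p1 * q2))); last by rewrite FE mul1r.
by field; rewrite k0.
Qed.

End formula.

(** * Wronskians and solutions with prescribed asymptotics *)

Section evans.
Context {R : realType}.
Local Notation C := R[i].
Local Notation leb := (@lebesgue_measure R).
Local Notation Re := (@complex.Re R).
Local Notation Im := (@complex.Im R).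
Local Notation normc := (@Normc.normc R).
Implicit Types (V mu phi u g f F : R -> C) (k l z s : C).

Lemma wronskian_cst V l mu1 mu1' mu2 mu2' : solution_pair V l mu1 mu1' ->
  solution_pair V l mu2 mu2' -> forall x y : R,
  mu1 x * mu2' x - mu1' x * mu2 x = mu1 y * mu2' y - mu1' y * mu2 y.
Proof.
move=> [p1 p1'] [p2 p2'].
apply: (@cprimitive0_cst R (fun x => mu1 x * mu2' x - mu1' x * mu2 x)).
apply: cprimitive_eq (cprimitiveB (cprimitiveM p1 p2') (cprimitiveM p1' p2)) => t //=.
ring.
Qed.

(** For Re k > 0 the equation of phi is damped, so that phi follows u. *)
Lemma phase_bounded k phi u (U : R) :
  cprimitive phi (fun t => u t - 2 * k * phi t + 0) -> 0 < Re k ->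
  (forall x, 0 <= x -> normc (u x) <= U) ->
  exists2 B : R, 0 <= B & forall x, 0 <= x -> normc (phi x) <= B.
Proof.
move=> pphi r0 uU; set r := Re k in r0.
have pS := primitive_normsq pphi.
pose S t := normsq (phi t).
pose c := U ^+ 2 / (4 * r ^+ 2).
have c0 : 0 <= c.
  by rewrite divr_ge0 ?sqr_ge0// mulr_ge0 ?sqr_ge0.
have pe := primitive_expR (primitive_linear (2 * r)).
have pZ := primitiveB (primitiveM pe pS) (primitiveZ c pe).
exists (Num.sqrt (S 0 + c)); first exact: sqrtr_ge0.
move=> x x0; rewrite normcE; apply: ler_wsqrtr.
have := primitive_le pZ x0.
rewrite mulr0 expR0 mul1r mulr1 -/(S 0).
move=> /(_ _)/wrap[|h].
  move=> t /andP[t0 _].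
  set E := expR _; have E0 : 0 <= E by exact: expR_ge0.
  have -> : 2 * r * E * normsq (phi t) +
    E * (2 * (Re (phi t) * Re (u t - 2 * k * phi t + 0) +
              Im (phi t) * Im (u t - 2 * k * phi t + 0))) - c * (2 * r * E) =
    E * (2 * r * normsq (phi t) + 2 * inner (phi t) (u t - 2 * k * phi t) - 2 * r * c).
    by rewrite /inner addr0; ring.
  rewrite pmulr_rle0//; last exact: expR_gt0.
  have -> : 2 * r * c = normsq (u t) / (2 * r) + (U ^+ 2 - normsq (u t)) / (2 * r).
    by rewrite /c; field; rewrite gt_eqF.
  have h1 : 0 <= (U ^+ 2 - normsq (u t)) / (2 * r).
    rewrite divr_ge0 ?mulr_ge0 ?(ltW r0)// subr_ge0 -sqr_normc.
    have := uU t t0; have := normc_ge0 (u t); nra.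
  have h2 : 2 * r * normsq (phi t) + 2 * inner (phi t) (u t - 2 * k * phi t)
      - normsq (u t) / (2 * r) <= 0.
    have i0 : 0 < (2 * r)^-1 by rewrite invr_gt0 mulr_gt0.
    have -> : 2 * r * normsq (phi t) + 2 * inner (phi t) (u t - 2 * k * phi t)
      - normsq (u t) / (2 * r) = - ((2 * r)^-1 * ((2 * r * Re (phi t) - Re (u t)) ^+ 2
        + (2 * r * Im (phi t) - Im (u t)) ^+ 2)).
      by rewrite /inner /normsq !creim /= -/r; field; rewrite gt_eqF.
    by rewrite oppr_le0 mulr_ge0 ?(ltW i0)// addr_ge0// sqr_ge0.
  by lra.
have E1 : 1 <= expR (2 * r * x).
  by rewrite -[leLHS]expR0 ler_expR !mulr_ge0// ltW.
have {}h : expR (2 * r * x) * (normsq (phi x) - c) <= S 0 - c by lra.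
rewrite -lerBlDr; have [n|n] := leP (normsq (phi x) - c) 0.
  by apply: (le_trans n); exact: normsq_ge0.
have : 1 * (normsq (phi x) - c) <= expR (2 * r * x) * (normsq (phi x) - c).
  by apply: ler_wpM2r => //; exact: ltW.
by lra.
Qed.

(** At +oo the solution mup and its derivative behave like those of
    cexp (- k x), whose Wronskian with mu is the function u of the phase system.
    So the Wronskian of mup and mu, being constant, is the limit of u. The
    correction terms vanish because phi and u are bounded. *)
Lemma jost_plus_coef a V k mup mup' mu mu' : 0 < a -> exp_decay a V -> 0 < Re k ->
  solution_pair V (- k ^+ 2) mup mup' -> solution_pair V (- k ^+ 2) mu mu' ->
  (mup x * cexp (k * x%:C)) @[x --> +oo] --> (1 : R[i]^o) ->
  (mup' x * cexp (k * x%:C)) @[x --> +oo] --> (- k : R[i]^o) ->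
  plus_coef V k mu mu' = mup 0 * mu' 0 - mup' 0 * mu 0.
Proof.
move=> a0 dV r0 solp sol limp limp'.
have ka : - a < Re k by lra.
have [pphi pu] := solution_phase_system sol.
have ti := tail_solution a0 dV ka sol.
set phi := (fun t => cexp (- k * t%:C) * mu t) in pphi pu ti.
set u := (fun t => cexp (- k * t%:C) * (mu' t + k * mu t)) in pphi pu ti.
pose p := plus_coef V k mu mu'; rewrite -/p.
have mphi := cmeasurable_cprimitive pphi.
have [mV iV] := dV; have mVp := cmeasurableM mV mphi.
have puE x : p - u x = cintegral `[x, +oo[ (fun y => V y * phi y).
  have [_ ->] := cintegral_ray x pu ti.
  by rewrite /p /plus_coef -/phi /u mulr0 cexp0 mul1r; ring.
have rayS x : 0 <= x -> `[x, +oo[%classic `<=` (`[0, +oo[%classic : set R).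
  by move=> x0; apply: subset_itvr; rewrite bnd_simp.
have ray_le (B c : R) x : 0 <= B -> 0 <= x -> c < 2 * a ->
    (forall t, x <= t -> normc (V t * phi t) <= B * (expR (c * `|t|) * normc (V t))) ->
    normc (p - u x) <= 2 * (B * tail_mass V c).
  move=> B0 x0 ca dom.
  have i0 := integrable_sub (measurable_itv `[(0 : R), +oo[) (iV c ca).
  have i := integrable_sub (measurable_itv `[x, +oo[) (iV c ca).
  have iB := integrableZ_real B (measurable_itv `[x, +oo[) i.
  have dom' t : `[x, +oo[%classic t ->
      normc (V t * phi t) <= B * (expR (c * `|t|) * normc (V t)).
    by rewrite /= in_itv/= andbT; exact: dom.
  rewrite puE; apply: le_trans (normc_cintegral_le _ mVp iB dom') _ => //.
  rewrite RintegralZl//; apply: ler_wpM2l => //; apply: ler_wpM2l => //.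
  rewrite /tail_mass /Rintegral fine_le ?integrable_fin_num//.
  apply: ge0_subset_integral => //.
  - by have := measurable_int _ i0.
  - by move=> t _; rewrite lee_fin mulr_ge0 ?expR_ge0 ?normc_ge0.
  - exact: rayS.
have a2 : a < 2 * a by lra.
have ck : 0 < a + 2 * Re k by lra.
have [B1 B10 hB1] := solution_growth a0 dV sol a0 ck.
pose U := normc p + 2 * (B1 * tail_mass V a).
have uU x : 0 <= x -> normc (u x) <= U.
  move=> x0; have -> : u x = p + - (p - u x) by ring.
  apply: le_trans (le_normcD _ _) _; rewrite normcN lerD2l.
  apply: ray_le => // t xt; have t0 := le_trans x0 xt.
  rewrite Normc.normcM mulrA mulrC; apply: ler_wpM2r; first exact: normc_ge0.
  by rewrite ger0_norm//; exact: hB1.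
have [B B0 hB] := phase_bounded pphi r0 uU.
pose T := 2 * (B * tail_mass V a).
have puT x : 0 <= x -> normc (p - u x) <= T * expR (- (a * x)).
  move=> x0.
  have -> : T * expR (- (a * x)) = 2 * ((B * expR (- (a * x))) * tail_mass V a).
    by rewrite /T; ring.
  apply: ray_le => //; first by rewrite mulr_ge0// expR_ge0.
  move=> t xt; have t0 := le_trans x0 xt.
  rewrite Normc.normcM mulrC mulrA; apply: ler_wpM2r; first exact: normc_ge0.
  apply: (le_trans (hB t t0)); rewrite -mulrA ler_peMr//.
  by rewrite -expRD -[leLHS]expR0 ler_expR ger0_norm// addrC subr_ge0 ler_pM2l.
set w := mup 0 * mu' 0 - mup' 0 * mu 0.
apply/eqP; rewrite -subr_eq0; apply/eqP; apply: Normc.eq0_normc; apply/eqP.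
rewrite eq_le normc_ge0 andbT leNgt; apply/negP => e0.
set e := normc (p - w) in e0.
pose M := T + (U + normc k * B) + B.
have T0 : 0 <= T by rewrite /T !mulr_ge0// tail_mass_ge0.
have U0 : 0 <= U by apply: le_trans (uU 0 (lexx _)); exact: normc_ge0.
have kB0 : 0 <= normc k * B by rewrite mulr_ge0// normc_ge0.
have M0 : 0 <= M by rewrite /M; lra.
pose ep := e / (M + 1).
have ep0 : 0 < ep by rewrite divr_gt0//; lra.
have epC : 0 < ep%:C :> C by rewrite ltcR.
have nf := (@cvgrPdist_lt C C^o _ (pinfty_nbhs R) _ _ _).1 limp _ epC.
have ng := (@cvgrPdist_lt C C^o _ (pinfty_nbhs R) _ _ _).1 limp' _ epC.
near (pinfty_nbhs R) => x.
have x0 : 0 <= x by near: x; apply: nbhs_pinfty_ge; rewrite num_real.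
have xe : ep^-1 / a < x by near: x; apply: nbhs_pinfty_gt; rewrite num_real.
have fx : `|1 - mup x * cexp (k * x%:C)| < ep%:C.
  by near: x; exact: nf.
have gx : `|- k - mup' x * cexp (k * x%:C)| < ep%:C.
  by near: x; exact: ng.
rewrite complex_normE ltcR in fx; rewrite complex_normE ltcR in gx.
have ex : expR (- (a * x)) <= ep.
  rewrite expRN invf_ple ?posrE ?expR_gt0//.
  have := expR_ge1Dx (a * x); rewrite ltr_pdivrMr// in xe; lra.
have wx : w = mup x * mu' x - mup' x * mu x by exact: wronskian_cst solp sol _ _.
have EF : cexp (- k * x%:C) * cexp (k * x%:C) = 1 by rewrite mulNr cexpN.
have pw : p - w = (p - u x) + (1 - mup x * cexp (k * x%:C)) * (u x - k * phi x) -
    (- k - mup' x * cexp (k * x%:C)) * phi x.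
  transitivity (p - (cexp (- k * x%:C) * cexp (k * x%:C)) * w).
    by rewrite EF mul1r.
  by rewrite wx /u /phi; ring.
have : e <= M * ep.
  rewrite /e pw; apply: le_trans (le_normcD _ _) _.
  rewrite normcN /M [leRHS]mulrDl; apply: lerD; last first.
    by rewrite Normc.normcM mulrC; apply: ler_pM; rewrite ?normc_ge0 ?(ltW gx)// hB.
  apply: le_trans (le_normcD _ _) _; rewrite [leRHS]mulrDl; apply: lerD.
    by apply: (le_trans (puT x x0)); exact: ler_wpM2l.
  rewrite Normc.normcM mulrC; apply: ler_pM; rewrite ?normc_ge0 ?(ltW fx)//.
  apply: le_trans (le_normcD _ _) _; rewrite normcN; apply: lerD.
    exact: uU.
  by rewrite Normc.normcM; apply: ler_wpM2l; [exact: normc_ge0|exact: hB].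
apply/negP; rewrite -ltNge /ep mulrCA -[ltRHS]mulr1 ltr_pM2l//.
by rewrite ltr_pdivrMr ?mul1r; lra.
Unshelve. all: by end_near. Qed.

End evans.

(** * From a zero of the determinant to an eigenfunction *)

Section eigenvalue.
Context {R : realType}.
Local Notation C := R[i].
Local Notation leb := (@lebesgue_measure R).
Local Notation Re := (@complex.Re R).
Local Notation Im := (@complex.Im R).
Local Notation normc := (@Normc.normc R).
Implicit Types (V mu phi u g f F : R -> C) (k l z s : C).

Lemma solution_pair_comb V l mu1 mu1' mu2 mu2' c1 c2 :
  solution_pair V l mu1 mu1' -> solution_pair V l mu2 mu2' ->
  solution_pair V l (fun x => c1 * mu1 x + c2 * mu2 x)
    (fun x => c1 * mu1' x + c2 * mu2' x).
Proof.
move=> [p1 p1'] [p2 p2']; split.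
  exact: cprimitiveD (cprimitiveZ _ p1) (cprimitiveZ _ p2).
apply: cprimitive_eq (cprimitiveD (cprimitiveZ c1 p1') (cprimitiveZ c2 p2')) => t //=.
ring.
Qed.

Lemma plus_coef_comb a V k mu1 mu1' mu2 mu2' c1 c2 : 0 < a -> exp_decay a V ->
  - a < Re k ->
  solution_pair V (- k ^+ 2) mu1 mu1' -> solution_pair V (- k ^+ 2) mu2 mu2' ->
  plus_coef V k (fun x => c1 * mu1 x + c2 * mu2 x) (fun x => c1 * mu1' x + c2 * mu2' x)
  = c1 * plus_coef V k mu1 mu1' + c2 * plus_coef V k mu2 mu2'.
Proof.
move=> a0 dV ka s1 s2; rewrite /plus_coef.
have m := measurable_itv `[(0 : R), +oo[.
have [i1 e1] := cintegrableZ c1 m (tail_solution a0 dV ka s1).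
have [i2 e2] := cintegrableZ c2 m (tail_solution a0 dV ka s2).
have [_ e] := cintegrableD m i1 i2.
rewrite e1 e2 in e.
rewrite (_ : (fun y => V y * (cexp (- k * y%:C) * (c1 * mu1 y + c2 * mu2 y))) =
  (fun t => c1 * (V t * (cexp (- k * t%:C) * mu1 t)) +
            c2 * (V t * (cexp (- k * t%:C) * mu2 t)))); last first.
  by apply/funext => t; ring.
by rewrite e; ring.
Qed.

Lemma minus_coef_comb a V k mu1 mu1' mu2 mu2' c1 c2 : 0 < a -> exp_decay a V ->
  - a < Re k ->
  solution_pair V (- k ^+ 2) mu1 mu1' -> solution_pair V (- k ^+ 2) mu2 mu2' ->
  minus_coef V k (fun x => c1 * mu1 x + c2 * mu2 x) (fun x => c1 * mu1' x + c2 * mu2' x)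
  = c1 * minus_coef V k mu1 mu1' + c2 * minus_coef V k mu2 mu2'.
Proof.
move=> a0 dV ka s1 s2; rewrite /minus_coef.
rewrite -(plus_coef_comb c1 c2 a0 (exp_decay_opp dV) ka (solution_pair_opp s1)
  (solution_pair_opp s2)).
by congr plus_coef; apply/funext => t; ring.
Qed.

(** Cramer's rule with the three constant Wronskians; in particular a solution is
    determined by its initial values. *)
Lemma solution_basis V l nu1 nu1' nu2 nu2' mu mu' :
  solution_pair V l nu1 nu1' -> nu1 0 = 1 -> nu1' 0 = 0 ->
  solution_pair V l nu2 nu2' -> nu2 0 = 0 -> nu2' 0 = 1 ->
  solution_pair V l mu mu' ->
  mu = fun x => mu 0 * nu1 x + mu' 0 * nu2 x.
Proof.
move=> s1 a1 b1 s2 a2 b2 s; apply/funext => x.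
have w12 := wronskian_cst s1 s2 x 0; rewrite a1 b1 a2 b2 in w12.
have w1 := wronskian_cst s1 s x 0; rewrite a1 b1 in w1.
have w2 := wronskian_cst s s2 x 0; rewrite a2 b2 in w2.
have {}w12 : nu1 x * nu2' x - nu1' x * nu2 x = 1 by rewrite w12; ring.
have {}w1 : nu1 x * mu' x - nu1' x * mu x = mu' 0 by rewrite w1; ring.
have {}w2 : mu x * nu2' x - mu' x * nu2 x = mu 0 by rewrite w2; ring.
rewrite -w1 -w2 -[LHS]mulr1 -w12; ring.
Qed.

Lemma continuous_ae0 (f : R -> R) : continuous f ->
  {ae leb, forall x, f x = 0} -> forall x, f x = 0.
Proof.
move=> cf f0 x.
have [F pF] := locint_primitive (locint_continuous cf).
have p0 : primitive F (fun=> 0).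
  split=> [|a b ab]; first exact: locint_cst.
  rewrite pF.2//; congr fine; apply: ae_eq_integral => //.
  - by apply/measurable_EFinP; apply: measurable_funTS; exact: continuous_measurable_fun.
  - by apply: (@filterS _ _ (ae_filter_ringOfSetsType leb)) f0 => t -> _.
have [_ <-] := primitive_is_derive x pF cf.
by have [_ <-] := primitive_is_derive x p0 (@cst_continuous _ _ 0).
Qed.

Lemma continuous_cae0 f F : cprimitive F f -> {ae leb, forall x, F x = 0} ->
  forall x, F x = 0.
Proof.
move=> [p1 p2] F0 x; apply: complex_eq.
  apply: (continuous_ae0 (primitive_continuous p1)).
  by apply: (@filterS _ _ (ae_filter_ringOfSetsType leb)) F0 => t ->.
apply: (continuous_ae0 (primitive_continuous p2)).
by apply: (@filterS _ _ (ae_filter_ringOfSetsType leb)) F0 => t ->.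
Qed.

(** A solution grows at most at any rate above |Re k|, which is less than a. *)
Lemma solution_in_L2 a V k mu mu' : 0 < a -> exp_decay a V -> - a < Re k < a ->
  solution_pair V (- k ^+ 2) mu mu' ->
  in_L2 (fun x => expR (- (2 * a * `|x|))) mu.
Proof.
move=> a0 dV /andP[ka ak] sol.
have [m1 m2] := cmeasurable_cprimitive sol.1.
split=> //.
(* b lies strictly between |Re k| and a. *)
pose m := Num.max (Re k) (- Re k); pose b := (m + a) / 2.
have mk : Re k <= m by rewrite le_max lexx.
have mk' : - Re k <= m by rewrite le_max lexx orbT.
have ma : m < a by rewrite gt_max ak ltrNl ka.
have half W nu nu' : exp_decay a W -> solution_pair W (- k ^+ 2) nu nu' ->
    exists2 B : R, 0 <= B & forall x, 0 <= x -> normc (nu x) <= B * expR (b * x).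
  move=> dW sW.
  have c0 : 0 < b - Re k by rewrite /b; lra.
  have ck : 0 < (b - Re k) + 2 * Re k by rewrite /b; lra.
  have [B B0 hB] := solution_growth a0 dW sW c0 ck.
  exists B => // x x0; have := hB x x0.
  rewrite Normc.normcM normc_cexp.
  have -> : Re (- k * x%:C) = - (Re k * x) by rewrite !creim; ring.
  rewrite expRN mulrC ler_pdivrMr ?expR_gt0// -mulrA -expRD.
  by have -> : (b - Re k) * x + Re k * x = b * x by ring.
have [B1 B10 h1] := half _ _ _ dV sol.
have [B2 B20 h2] := half _ _ _ (exp_decay_opp dV) (solution_pair_opp sol).
pose B := B1 + B2.
have hB x : normc (mu x) <= B * expR (b * `|x|).
  have [x0|/ltW x0] := leP 0 x.
    apply: (le_trans (h1 x x0)); rewrite ger0_norm//.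
    by apply: ler_wpM2r; [exact: expR_ge0|rewrite lerDl].
  have := h2 (- x); rewrite oppr_ge0 opprK => /(_ x0) h; apply: (le_trans h).
  rewrite ler0_norm//.
  by apply: ler_wpM2r; [exact: expR_ge0|rewrite lerDr].
have i : leb.-integrable setT (EFin \o (fun x => B ^+ 2 * expR (- (2 * (a - b) * `|x|)))).
  by apply: integrableZ_real => //; apply: integrable_expR_abs; rewrite /b; lra.
have : leb.-integrable setT
    (EFin \o (fun x => expR (- (2 * a * `|x|)) * normc (mu x) ^+ 2)).
  apply: (integrable_dominated _ _ i) => //.
    apply: measurable_funM; last by apply: measurable_funX; exact: measurable_normc.
    apply: continuous_measurable_fun => x.
    apply: continuous_comp; last exact: continuous_expR.
    apply: cvgN; apply: cvgM; first exact: cvg_cst.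
    exact: norm_continuous.
  move=> x _; rewrite ger0_norm; last by rewrite mulr_ge0 ?expR_ge0 ?sqr_ge0.
  have -> : B ^+ 2 * expR (- (2 * (a - b) * `|x|)) =
    expR (- (2 * a * `|x|)) * (B * expR (b * `|x|)) ^+ 2.
    rewrite exprMn mulrCA [expR (b * _) ^+ 2]expr2 -!expRD.
    by congr (_ * expR _); ring.
  apply: ler_wpM2l; first exact: expR_ge0.
  have B0 : 0 <= B by rewrite addr_ge0.
  by rewrite ler_pXn2r ?nnegrE ?normc_ge0 ?mulr_ge0 ?expR_ge0.
move=> /integrableP[_]; apply: le_lt_trans.
rewrite le_eqVlt; apply/orP; left; apply/eqP; apply: eq_integral => x _ /=.
by rewrite (@ger0_norm _ (_ * _))// mulr_ge0 ?expR_ge0 ?sqr_ge0.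
Qed.

(** A vanishing determinant gives a nonzero solution mu both of whose coefficients
    are zero. Then D vanishes on mu, and this is the integral equation. *)
Lemma eigenvalue_of_DD0 a V s nu1 nu1' nu2 nu2' x :
  0 < a -> exp_decay a V -> P a s ->
  solution_pair V (lam s) nu1 nu1' -> nu1 0 = 1 -> nu1' 0 = 0 ->
  solution_pair V (lam s) nu2 nu2' -> nu2 0 = 0 -> nu2' 0 = 1 ->
  DD V s nu1 nu2 x = 0 -> generalized_eigenvalue V a s.
Proof.
move=> a0 dV [s0 /andP[sa1 sa2]] s1 a1 b1 s2 a2 b2.
rewrite (DD_solution x a0 dV s0 sa2 s1 s2).
have k0 := sqrtN_neq0 s0.
have ka : - a < Re (sqrtN s) by rewrite Re_sqrtN ltrN2.
have ka2 : - a < Re (sqrtN s) < a by rewrite ka Re_sqrtN ltrNl.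
move: (s1) (s2); rewrite lamE => s1' s2'.
pose p1 := plus_coef V (sqrtN s) nu1 nu1'; pose q1 := minus_coef V (sqrtN s) nu1 nu1'.
pose p2 := plus_coef V (sqrtN s) nu2 nu2'; pose q2 := minus_coef V (sqrtN s) nu2 nu2'.
rewrite -/p1 -/p2 -/q1 -/q2 => /eqP.
rewrite mulf_eq0 invr_eq0 mulf_eq0 pnatr_eq0 (negbTE k0)/= subr_eq0 => /eqP det0.
have [c1 [c2 [c0 cp cq]]] : exists c1, exists c2,
    [/\ (c1 != 0) || (c2 != 0), c1 * p1 + c2 * p2 = 0 & c1 * q1 + c2 * q2 = 0].
  have [p0|p0] := boolP ((p1 != 0) || (p2 != 0)).
    exists p2, (- p1); split; first by rewrite oppr_eq0 orbC.
      by ring.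
    by rewrite mulNr -det0; ring.
  move: p0; rewrite negb_or !negbK => /andP[/eqP z1 /eqP z2].
  have [q0|q0] := boolP ((q1 != 0) || (q2 != 0)).
    exists q2, (- q1); split; first by rewrite oppr_eq0 orbC.
      by rewrite z1 z2; ring.
    by ring.
  move: q0; rewrite negb_or !negbK => /andP[/eqP y1 /eqP y2].
  by exists 1, 1; split; rewrite ?oner_eq0// ?z1 ?z2 ?y1 ?y2; ring.
have sol := solution_pair_comb c1 c2 s1 s2.
set mu := (fun x => c1 * nu1 x + _) in sol.
set mu' := (fun x => c1 * nu1' x + _) in sol.
exists mu; split.
- by move: (sol); rewrite lamE => /(solution_in_L2 a0 dV ka2).
- move=> /(continuous_cae0 sol.1) mu0.
  have [_ e'] := solution_pair_is sol.
  have z1 : c1 = 0 by have := mu0 0; rewrite /mu a1 a2 => <-; ring.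
  have z2 : c2 = 0.
    have : mu' 0 = 0.
      rewrite -e' (_ : mu = fun=> 0); last exact/funext.
      by apply: complex_eq; rewrite /cderiv /= derive1_cst.
    by rewrite /mu' b1 b2 => <-; ring.
  by move: c0; rewrite z1 z2 eqxx.
apply: aeW => y.
have := D_solution a0 dV s0 sa2 sol.
have -> : plus_coef V (sqrtN s) mu mu' = 0.
  by rewrite (plus_coef_comb c1 c2 a0 dV ka s1' s2').
have -> : minus_coef V (sqrtN s) mu mu' = 0.
  by rewrite (minus_coef_comb c1 c2 a0 dV ka s1' s2').
move=> /(congr1 (fun f => f y)); rewrite /D !mulr0 addr0 mulr0 => h.
apply/eqP; rewrite -subr_eq0; apply/eqP; rewrite -[RHS]h; ring.
Qed.

End eigenvalue.

(** * From an eigenfunction to a zero of the determinant *)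

Section converse.
Context {R : realType}.
Local Notation C := R[i].
Local Notation leb := (@lebesgue_measure R).
Local Notation Re := (@complex.Re R).
Local Notation Im := (@complex.Im R).
Local Notation normc := (@Normc.normc R).
Implicit Types (V mu phi u g f F : R -> C) (k l z s : C).

Lemma cintegrable_ae (D : set (measurableTypeR R)) f g : measurable D ->
  cmeasurable f -> cmeasurable g -> {ae leb, forall x, f x = g x} ->
  cintegrable D f -> cintegrable D g /\ cintegral D g = cintegral D f.
Proof.
move=> mD [f1 f2] [g1 g2] fg.
have real (p q : R -> R) : measurable_fun setT p -> measurable_fun setT q ->
    {ae leb, forall x, p x = q x} -> leb.-integrable D (EFin \o p) ->
    leb.-integrable D (EFin \o q) /\ \int[leb]_(x in D) q x = \int[leb]_(x in D) p x.
  move=> mp mq pq /integrableP[_ ip].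
  have mp' : measurable_fun D p by exact: measurable_funTS.
  have mq' : measurable_fun D q by exact: measurable_funTS.
  split.
    apply/integrableP; split; first exact/measurable_EFinP.
    apply: le_lt_trans ip; rewrite le_eqVlt; apply/orP; left; apply/eqP.
    apply: ae_eq_integral => //.
    - by apply/measurable_EFinP; exact: measurableT_comp.
    - by apply/measurable_EFinP; exact: measurableT_comp.
    - by apply: (@filterS _ _ (ae_filter_ringOfSetsType leb)) pq => t pqt _ /=; rewrite pqt.
  congr fine; apply: ae_eq_integral => //.
  - exact/measurable_EFinP.
  - exact/measurable_EFinP.
  - by apply: (@filterS _ _ (ae_filter_ringOfSetsType leb)) pq => t pqt _ /=; rewrite pqt.
move=> [i1 i2].
have [|j1 e1] := real _ _ f1 g1 _ i1.
  by apply: (@filterS _ _ (ae_filter_ringOfSetsType leb)) fg => t ->.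
have [|j2 e2] := real _ _ f2 g2 _ i2.
  by apply: (@filterS _ _ (ae_filter_ringOfSetsType leb)) fg => t ->.
by split; [split|rewrite /cintegral e1 e2].
Qed.

Lemma cintegrable_sub (D : set (measurableTypeR R)) f : measurable D ->
  cintegrable setT f -> cintegrable D f.
Proof. by move=> mD [i1 i2]; split; exact: integrable_sub. Qed.

Lemma cprimitive_right_ray f : cintegrable setT f ->
  cprimitive (fun x => cintegral `[x, +oo[ f) (fun x => - f x).
Proof.
move=> i; have [i1 i2] := i.
have l1 : locint (fun t => Re (f t)) by move=> x y; exact: (integrable_sub _ i1).
have l2 : locint (fun t => Im (f t)) by move=> x y; exact: (integrable_sub _ i2).
have [F1 p1] := locint_primitive l1; have [F2 p2] := locint_primitive l2.
have pF : cprimitive (fun x => (F1 x) +i* (F2 x)) f by [].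
have i0 := cintegrable_sub (measurable_itv `[(0 : R), +oo[) i.
set F := (fun x => _) in pF.
have e : (fun x => cintegral `[x, +oo[ f) =
    (fun x => (cintegral `[0, +oo[ f + F 0) - F x).
  by apply/funext => x; have [_ ->] := cintegral_ray x pF i0; ring.
rewrite e; apply: cprimitive_eq (cprimitiveB (cprimitive_cst _) pF) => t //=.
by rewrite sub0r.
Qed.

Lemma cintegrable_oppT f : cintegrable setT f -> cintegrable setT (fun t => f (- t)).
Proof.
by move=> [/integrable_opp[i1 _] /integrable_opp[i2 _]]; split.
Qed.

Lemma cprimitive_left_ray f : cintegrable setT f ->
  cprimitive (fun x => cintegral `]-oo, x] f) f.
Proof.
move=> i; have iN := cintegrable_oppT i.
apply: cprimitive_eq (cprimitive_opp (cprimitive_right_ray iN)) => x /=.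
  have [|_ ->//] := @cintegral_opp_ray R f x.
  exact: cintegrable_sub.
by rewrite !opprK.
Qed.

Lemma in_L2_integrable (w : R -> R) f : measurable_fun [set: R] w ->
  (forall x, 0 <= w x) -> in_L2 w f ->
  leb.-integrable setT (EFin \o (fun x => w x * normc (f x) ^+ 2)).
Proof.
move=> mw w0 [m1 m2 fin]; apply/integrableP; split.
  apply/measurable_EFinP; apply: measurable_funM => //.
  by apply: measurable_funX; exact: measurable_normc.
apply: le_lt_trans fin; rewrite le_eqVlt; apply/orP; left; apply/eqP.
by apply: eq_integral => x _ /=; rewrite ger0_norm// mulr_ge0 ?sqr_ge0.
Qed.

(** V * mu is expR (- a |x|) times the product of two square integrable functions,
    expR (2 a |x|) * V x and expR (- a |x|) * mu x, and the exponential rate is at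
    most a. *)
Lemma cintegrable_pairing a V mu k : 0 < a -> cmeasurable V ->
  in_L2 (fun=> 1) (fun x => (expR (2 * a * `|x|))%:C * V x) ->
  in_L2 (fun x => expR (- (2 * a * `|x|))) mu -> - a <= Re k <= a ->
  cmeasurable (fun y => cexp (k * y%:C) * V y * mu y) /\
  cintegrable setT (fun y => cexp (k * y%:C) * V y * mu y).
Proof.
move=> a0 mV V_L2 mu_L2 /andP[ka ak].
have mm : cmeasurable mu by case: mu_L2.
have mE : cmeasurable (fun y => cexp (k * y%:C)).
  exact: cmeasurable_cprimitive (cprimitive_cexp k).
have mf := cmeasurableM (cmeasurableM mE mV) mm.
split=> //.
have iV := in_L2_integrable (@measurable_cst _ _ _ _ _ _) (fun=> ler01) V_L2.
have mw : measurable_fun [set: R] (fun x : R => expR (- (2 * a * `|x|))).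
  apply: continuous_measurable_fun => x.
  apply: continuous_comp; last exact: continuous_expR.
  by apply: cvgN; apply: cvgM; [exact: cvg_cst|exact: norm_continuous].
have imu := in_L2_integrable mw (fun=> expR_ge0 _) mu_L2.
apply: (cintegrable_dominated _ mf (integrableD_real _ iV imu)) => // x _.
rewrite [normc (_ * mu x)]Normc.normcM [normc (cexp _ * _)]Normc.normcM normc_cexp.
rewrite [normc (_ * V x)]Normc.normcM mul1r exprMn.
have nC (r : R) : normc r%:C = `|r|.
  by rewrite normcE /normsq !creim expr0n/= addr0 sqrtr_sqr.
rewrite nC ger0_norm ?expR_ge0//.
set v := normc (V x); set m := normc (mu x).
have v0 : 0 <= v by exact: normc_ge0.
have m0 : 0 <= m by exact: normc_ge0.
have kx : Re (k * x%:C) <= a * `|x|.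
  rewrite !creim mulr0 subr0; apply: le_trans (ler_norm _) _; rewrite normrM.
  by apply: ler_wpM2r => //; rewrite ler_norml ka ak.
have e1 : expR (Re (k * x%:C)) <= expR (a * `|x|) by rewrite ler_expR.
have -> : expR (2 * a * `|x|) = expR (a * `|x|) ^+ 2.
  by rewrite expr2 -expRD; congr expR; ring.
have -> : expR (- (2 * a * `|x|)) = expR (- (a * `|x|)) ^+ 2.
  by rewrite expr2 -expRD; congr expR; ring.
set E := expR (a * `|x|) in e1 *; have E0 : 0 < E by exact: expR_gt0.
rewrite expRN -/E.
have step : expR (Re (k * x%:C)) * v * m <= E * v * m.
  by do 2 apply: ler_wpM2r => //.
apply: (le_trans step).
have -> : E * v * m = (E ^+ 2 * v) * (E^-1 * m).
  by field; rewrite gt_eqF.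
rewrite -exprMn -exprMn.
set p := E ^+ 2 * v; set q := E^-1 * m.
have : 0 <= p by rewrite mulr_ge0 ?sqr_ge0.
have : 0 <= q by rewrite mulr_ge0 ?invr_ge0// ltW.
have := sqr_ge0 (p - q); nra.
Qed.

(** The right-hand side of the integral equation is a continuous representative mt
    of the eigenfunction. Differentiating it twice shows that mt solves the
    equation, and at 0 its values and its two integrals cancel in both
    coefficients. As mt is a nonzero combination of nu1 and nu2, the matrix of
    coefficients is singular. *)
Lemma DD0_of_eigenvalue a V s nu1 nu1' nu2 nu2' x :
  0 < a -> in_L2 (fun=> 1) (fun x => (expR (2 * a * `|x|))%:C * V x) -> P a s ->
  solution_pair V (lam s) nu1 nu1' -> nu1 0 = 1 -> nu1' 0 = 0 ->
  solution_pair V (lam s) nu2 nu2' -> nu2 0 = 0 -> nu2' 0 = 1 ->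
  generalized_eigenvalue V a s -> DD V s nu1 nu2 x = 0.
Proof.
move=> a0 V_L2 [s0 /andP[sa1 sa2]] s1 a1 b1 s2 a2 b2 [mu [mu_L2 mu_neq mu_eq]].
have dV := exp_decay_of_L2 a0 V_L2.
rewrite (DD_solution x a0 dV s0 sa2 s1 s2).
have k0 := sqrtN_neq0 s0.
have ka : - a < Re (sqrtN s) by rewrite Re_sqrtN ltrN2.
have ak : Re (sqrtN s) < a by rewrite Re_sqrtN ltrNl.
set k := sqrtN s in k0 ka ak *.
have [mV _] := dV.
have bN : - a <= Re (- k) <= a by rewrite creim lerN2 lerNl !ltW.
have bP : - a <= Re k <= a by rewrite !ltW.
have [_ iR] := cintegrable_pairing a0 mV V_L2 mu_L2 bN.
have [_ iL] := cintegrable_pairing a0 mV V_L2 mu_L2 bP.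
pose fR f y := cexp (- k * y%:C) * V y * f y.
pose fL f y := cexp (k * y%:C) * V y * f y.
pose A f x := cintegral `[x, +oo[ (fR f).
pose B f x := cintegral `]-oo, x] (fL f).
pose G f x := - (2 * k)^-1 * (cexp (k * x%:C) * A f x + cexp (- k * x%:C) * B f x).
have pexp := cprimitive_cexp k; have pexpN := cprimitive_cexp (- k).
have greenE x0 : - green_right V s mu x0 - green_left V s mu x0 = G mu x0.
  rewrite /green_right /green_left -/k.
  have eR : (fun y => cexp (- k * (y - x0)%:C) * V y * mu y) =
      (fun y => cexp (k * x0%:C) * fR mu y).
    apply/funext => y; rewrite /fR.
    have -> : - k * (y - x0)%:C = k * x0%:C + - k * y%:C.
      by apply: complex_eq; rewrite !creim; ring.
    by rewrite cexpD; ring.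
  have eL : (fun y => cexp (k * (y - x0)%:C) * V y * mu y) =
      (fun y => cexp (- k * x0%:C) * fL mu y).
    apply/funext => y; rewrite /fL.
    have -> : k * (y - x0)%:C = - k * x0%:C + k * y%:C.
      by apply: complex_eq; rewrite !creim; ring.
    by rewrite cexpD; ring.
  have mR := measurable_itv `[x0, +oo[; have mL := measurable_itv `]-oo, x0].
  rewrite eR eL.
  have [_ ->] := cintegrableZ (cexp (k * x0%:C)) mR (cintegrable_sub mR iR).
  have [_ ->] := cintegrableZ (cexp (- k * x0%:C)) mL (cintegrable_sub mL iL).
  by rewrite /G /A /B; ring.
pose mt := G mu.
have pmt0 := cprimitiveZ (- (2 * k)^-1)
  (cprimitiveD (cprimitiveM pexp (cprimitive_right_ray iR))
    (cprimitiveM pexpN (cprimitive_left_ray iL))).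
have mmt : cmeasurable mt by exact: cmeasurable_cprimitive pmt0.
have mm : cmeasurable mu by case: mu_L2.
have ae_mt : {ae leb, forall x, mu x = mt x}.
  apply: (@filterS _ _ (ae_filter_ringOfSetsType leb)) mu_eq => t ->.
  by rewrite greenE.
have mfR f : cmeasurable f -> cmeasurable (fR f).
  by move=> mf; do 2 apply: cmeasurableM => //; exact: cmeasurable_cprimitive pexpN.
have mfL f : cmeasurable f -> cmeasurable (fL f).
  by move=> mf; do 2 apply: cmeasurableM => //; exact: cmeasurable_cprimitive pexp.
have aeR : {ae leb, forall x, fR mu x = fR mt x}.
  by apply: (@filterS _ _ (ae_filter_ringOfSetsType leb)) ae_mt => t; rewrite /fR => ->.
have aeL : {ae leb, forall x, fL mu x = fL mt x}.
  by apply: (@filterS _ _ (ae_filter_ringOfSetsType leb)) ae_mt => t; rewrite /fL => ->.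
have [jR _] := cintegrable_ae measurableT (mfR _ mm) (mfR _ mmt) aeR iR.
have [jL _] := cintegrable_ae measurableT (mfL _ mm) (mfL _ mmt) aeL iL.
have AE : A mu = A mt.
  apply/funext => y; have m := measurable_itv `[y, +oo[.
  have [_ e] := cintegrable_ae m (mfR _ mm) (mfR _ mmt) aeR (cintegrable_sub m iR).
  by rewrite /A e.
have BE : B mu = B mt.
  apply/funext => y; have m := measurable_itv `]-oo, y].
  have [_ e] := cintegrable_ae m (mfL _ mm) (mfL _ mmt) aeL (cintegrable_sub m iL).
  by rewrite /B e.
have mtE y : mt y = - (2 * k)^-1 *
    (cexp (k * y%:C) * A mt y + cexp (- k * y%:C) * B mt y).
  by rewrite {1}/mt /G AE BE.
have pA : cprimitive (A mt) (fun x => - fR mt x) := cprimitive_right_ray jR.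
have pB : cprimitive (B mt) (fL mt) := cprimitive_left_ray jL.
pose mt' y := - 2^-1 * (cexp (k * y%:C) * A mt y - cexp (- k * y%:C) * B mt y).
have EF y : cexp (- k * y%:C) * cexp (k * y%:C) = 1 by rewrite mulNr cexpN.
have ERV y : cexp (k * y%:C) * fR mt y = V y * mt y.
  rewrite /fR; transitivity ((cexp (- k * y%:C) * cexp (k * y%:C)) * (V y * mt y)).
    by ring.
  by rewrite EF mul1r.
have FLV y : cexp (- k * y%:C) * fL mt y = V y * mt y.
  rewrite /fL; transitivity ((cexp (- k * y%:C) * cexp (k * y%:C)) * (V y * mt y)).
    by ring.
  by rewrite EF mul1r.
have sol : solution_pair V (lam s) mt mt'.
  split.
    apply: cprimitive_eq (cprimitiveZ (- (2 * k)^-1)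
      (cprimitiveD (cprimitiveM pexp pA) (cprimitiveM pexpN pB))) => t /=.
      by rewrite mtE.
    rewrite mulrN ERV FLV /mt'; by field; rewrite k0.
  apply: cprimitive_eq (cprimitiveZ (- 2^-1)
      (cprimitiveB (cprimitiveM pexp pA) (cprimitiveM pexpN pB))) => t //=.
  rewrite mulrN ERV FLV lamE -/k.
  have -> : (V t - - k ^+ 2) * mt t = V t * mt t + k ^+ 2 * mt t by ring.
  by rewrite [X in _ = _ + _ * X]mtE; field; rewrite k0.
move: (sol); rewrite lamE -/k => solk.
move: (s1) (s2); rewrite lamE -/k => s1' s2'.
have pc0 : plus_coef V k mt mt' = 0.
  rewrite /plus_coef /mt' [X in _ + k * X + _]mtE.
  have -> : (fun y => V y * (cexp (- k * y%:C) * mt y)) = fR mt.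
    by apply/funext => y; rewrite /fR; ring.
  rewrite -/(A mt 0) mulr0 cexp0 mulr0 cexp0; by field; rewrite k0.
have mc0 : minus_coef V k mt mt' = 0.
  rewrite /minus_coef /plus_coef oppr0 /mt' [X in _ + k * X + _]mtE.
  have -> : (fun y => V (- y) * (cexp (- k * y%:C) * mt (- y))) =
      (fun y => fL mt (- y)).
    apply/funext => y; rewrite /fL.
    have -> : k * (- y)%:C = - k * y%:C by apply: complex_eq; rewrite !creim; ring.
    by ring.
  have [|_ e] := @cintegral_opp_ray R (fL mt) 0.
    apply: cintegrable_sub => //; exact: (cintegrable_oppT jL).
  rewrite oppr0 in e; rewrite -e.
  rewrite -/(B mt 0) mulr0 cexp0 mulr0 cexp0; by field; rewrite k0.
have mt_comb := solution_basis s1 a1 b1 s2 a2 b2 sol.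
pose c1 := mt 0; pose c2 := mt' 0.
have mtC y : c1 * nu1 y + c2 * nu2 y = mt y.
  exact: esym (congr1 (fun f : R -> C => f y) mt_comb).
have mtCf : (fun y => c1 * nu1 y + c2 * nu2 y) = mt by apply/funext.
have pcc : c1 * plus_coef V k nu1 nu1' + c2 * plus_coef V k nu2 nu2' = 0.
  rewrite -(plus_coef_comb c1 c2 a0 dV ka s1' s2') mtCf -pc0 /plus_coef.
  by rewrite b1 b2 -/c2; ring.
have mcc : c1 * minus_coef V k nu1 nu1' + c2 * minus_coef V k nu2 nu2' = 0.
  rewrite -(minus_coef_comb c1 c2 a0 dV ka s1' s2') mtCf -mc0 /minus_coef /plus_coef.
  by rewrite oppr0 b1 b2 -/c2; ring.
set p1 := plus_coef V k nu1 nu1' in pcc *; set p2 := plus_coef V k nu2 nu2' in pcc *.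
set q1 := minus_coef V k nu1 nu1' in mcc *; set q2 := minus_coef V k nu2 nu2' in mcc *.
suff : q1 * p2 - p1 * q2 = 0 by move=> ->; rewrite mulr0.
have d1 : c1 * (q1 * p2 - p1 * q2) = 0.
  transitivity (p2 * (c1 * q1 + c2 * q2) - q2 * (c1 * p1 + c2 * p2)); first by ring.
  by rewrite pcc mcc !mulr0 subrr.
have d2 : c2 * (q1 * p2 - p1 * q2) = 0.
  transitivity (q1 * (c1 * p1 + c2 * p2) - p1 * (c1 * q1 + c2 * q2)); first by ring.
  by rewrite pcc mcc !mulr0 subrr.
apply/eqP; apply/negPn/negP => dn0.
move/eqP: d1; rewrite mulf_eq0 (negbTE dn0) orbF => /eqP z1.
move/eqP: d2; rewrite mulf_eq0 (negbTE dn0) orbF => /eqP z2.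
apply: mu_neq; apply: (@filterS _ _ (ae_filter_ringOfSetsType leb)) ae_mt => t ->.
by rewrite -mtC z1 z2; ring.
Qed.

End converse.

(** * Second-order expansion of the coefficients *)

Section holomorphy.
Context {R : realType}.
Local Notation C := R[i].
Local Notation leb := (@lebesgue_measure R).
Local Notation Re := (@complex.Re R).
Local Notation Im := (@complex.Im R).
Local Notation normc := (@Normc.normc R).
Implicit Types (V mu phi u g f F : R -> C) (k l z s h : C).

Lemma cprimitive_exists F f z : cprimitive F f ->
  exists2 G, cprimitive G F & G 0 = z.
Proof.
move=> [p1 p2].
have [G1 q1] := locint_primitive (locint_continuous (primitive_continuous p1)).
have [G2 q2] := locint_primitive (locint_continuous (primitive_continuous p2)).
exists (fun x => (G1 x +i* G2 x) + (z - (G1 0 +i* G2 0))); last by ring.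
have q : cprimitive (fun x => G1 x +i* G2 x) F by [].
by apply: cprimitive_eq (cprimitiveD q (cprimitive_cst _)) => t //=; rewrite addr0.
Qed.

(** Variation of constants; the determinant of the homogeneous solutions is
    cexp (- 2 k x). *)
Lemma phase_system_inhomogeneous V k nu1 nu1' nu2 nu2' g g' z :
  solution_pair V (- k ^+ 2) nu1 nu1' -> nu1 0 = 1 -> nu1' 0 = 0 ->
  solution_pair V (- k ^+ 2) nu2 nu2' -> nu2 0 = 0 -> nu2' 0 = 1 ->
  cprimitive g g' ->
  exists phi, exists u, [/\ phase_system V k phi u g, phi 0 = 0 & u 0 = z].
Proof.
move=> s1 a1 b1 s2 a2 b2 pg.
have [pp1 pu1] := solution_phase_system s1; have [pp2 pu2] := solution_phase_system s2.
have u10 : cexp (- k * (0 : R)%:C) * (nu1' 0 + k * nu1 0) = k.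
  by rewrite mulr0 cexp0 a1 b1; ring.
have u20 : cexp (- k * (0 : R)%:C) * (nu2' 0 + k * nu2 0) = 1.
  by rewrite mulr0 cexp0 a2 b2; ring.
have f10 : cexp (- k * (0 : R)%:C) * nu1 0 = 1 by rewrite mulr0 cexp0 a1; ring.
have f20 : cexp (- k * (0 : R)%:C) * nu2 0 = 0 by rewrite a2; ring.
have wr x : nu1 x * nu2' x - nu1' x * nu2 x = 1.
  by rewrite (wronskian_cst s1 s2 x 0) a1 a2 b1 b2; ring.
have EF (x : R) : cexp (- k * x%:C) * cexp (k * x%:C) = 1 by rewrite mulNr cexpN.
have det x : (cexp (k * x%:C) * cexp (k * x%:C)) *
    ((cexp (- k * x%:C) * nu1 x) * (cexp (- k * x%:C) * (nu2' x + k * nu2 x)) -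
     (cexp (- k * x%:C) * nu2 x) * (cexp (- k * x%:C) * (nu1' x + k * nu1 x))) = 1.
  transitivity ((cexp (- k * x%:C) * cexp (k * x%:C)) ^+ 2 *
    (nu1 x * nu2' x - nu1' x * nu2 x)); first by ring.
  by rewrite wr EF expr1n mul1r.
set f1 := (fun t => cexp (- k * t%:C) * nu1 t) in pp1 pu1 *.
set f2 := (fun t => cexp (- k * t%:C) * nu2 t) in pp2 pu2 *.
set u1 := (fun t => cexp (- k * t%:C) * (nu1' t + k * nu1 t)) in pp1 pu1 *.
set u2 := (fun t => cexp (- k * t%:C) * (nu2' t + k * nu2 t)) in pp2 pu2 *.
have pE := cprimitiveM (cprimitive_cexp k) (cprimitive_cexp k).
have [A pA A0] := cprimitive_exists 0 (cprimitiveM pE (cprimitiveM pg pu2)).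
have [B pB B0] := cprimitive_exists z (cprimitiveN (cprimitiveM pE (cprimitiveM pg pu1))).
exists (fun x => A x * f1 x + B x * f2 x), (fun x => A x * u1 x + B x * u2 x).
split; first split.
- apply: cprimitive_eq (cprimitiveD (cprimitiveM pA pp1) (cprimitiveM pB pp2)) => t //=.
  have gE : g t = cexp (k * t%:C) * cexp (k * t%:C) *
      (f1 t * u2 t - f2 t * u1 t) * g t by rewrite [_ * (_ - _)]det mul1r.
  rewrite [X in _ = _ + X]gE /f1 /f2 /u1 /u2; ring.
- apply: cprimitive_eq (cprimitiveD (cprimitiveM pA pu1) (cprimitiveM pB pu2)) => t //=.
  by rewrite /f1 /f2 /u1 /u2; ring.
- by rewrite A0 B0 /f2 f20; ring.
- by rewrite A0 B0 /u2 u20; ring.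
Qed.

(** Expansion to second order in h. The difference of the phase functions for
    k0 + h and k0 solves the system for k0 with a forcing of order h, hence is of
    order h. Subtracting h times the solution pd of the linearised system leaves a
    function with zero initial values and a forcing of order h^2. Each of the
    three estimates raises the exponential rate by ga, and the last rate c3 is
    still below the decay rate 2 a of V. *)
Lemma plus_coef_holomorphic a V (nu nu' : C -> R -> C) nu1 nu1' nu2 nu2' (al be k0 : C) :
  0 < a -> exp_decay a V -> - a < Re k0 ->
  (forall k, solution_pair V (- k ^+ 2) (nu k) (nu' k)) ->
  (forall k, nu k 0 = al /\ nu' k 0 = be) ->
  solution_pair V (- k0 ^+ 2) nu1 nu1' -> nu1 0 = 1 -> nu1' 0 = 0 ->
  solution_pair V (- k0 ^+ 2) nu2 nu2' -> nu2 0 = 0 -> nu2' 0 = 1 ->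
  exists L : C, exists B : R, exists2 e : R, 0 < e & forall h, normc h < e ->
    normc (plus_coef V (k0 + h) (nu (k0 + h)) (nu' (k0 + h)) -
           plus_coef V k0 (nu k0) (nu' k0) - h * L) <= B * normc h ^+ 2.
Proof.
move=> a0 dV ka sol ini s1 a1 b1 s2 a2 b2.
pose m := Num.max 0 (- (2 * Re k0)).
have m0 : 0 <= m by rewrite le_max lexx.
have mk : - (2 * Re k0) <= m by rewrite le_max lexx orbT.
have ma : m < 2 * a by rewrite gt_max mulr_gt0//=; lra.
pose ga := (2 * a - m) / 4.
have ga0 : 0 < ga by rewrite /ga; lra.
pose c1 := m + ga; pose c2 := m + 2 * ga; pose c3 := m + 3 * ga.
have c3a : c3 < 2 * a by rewrite /c3 /ga; lra.
have c2a : c2 < 2 * a by rewrite /c2 /ga; lra.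
pose d := ga / 2; have d0 : 0 < d by rewrite /d; lra.
have [B B0 hB] := phase_growth a0 dV d0.
(* The bound ga / 4 keeps d an admissible weight for k0 + h. *)
pose e := Num.min 1 (ga / 4).
have e0 : 0 < e by rewrite lt_min ltr01 /=; lra.
pose phi k t := cexp (- k * t%:C) * nu k t.
pose u k t := cexp (- k * t%:C) * (nu' k t + k * nu k t).
have ps k : phase_system V k (phi k) (u k) (fun=> 0) := solution_phase_system (sol k).
have phi0 k : phi k 0 = al by rewrite /phi mulr0 cexp0 (ini k).1 mul1r.
have u0 k : u k 0 = be + k * al.
  by rewrite /u mulr0 cexp0 (ini k).1 (ini k).2 mul1r.
have nsZ (x y : C) (M X : R) : normsq y <= M * X ->
    normsq (- (2 * x) * y) <= (4 * normc x ^+ 2 * M) * X.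
  move=> yM; rewrite !normsqM.
  have -> : normsq (- (2 * x)) = 4 * normc x ^+ 2.
    by rewrite sqr_normc /normsq !creim /=; ring.
  rewrite -mulrA; apply: ler_wpM2l => //.
  by rewrite mulr_ge0// sqr_ge0.
pose S := normsq al + (normc (be + k0 * al) + normc al) ^+ 2.
have S0 : 0 <= S by rewrite addr_ge0 ?normsq_ge0 ?sqr_ge0.
pose M1 := B * S; have M10 : 0 <= M1 by rewrite mulr_ge0.
have step1 h : normc h < e -> forall x, 0 <= x ->
    normsq (phi (k0 + h) x) <= M1 * expR (2 * c1 * x).
  move=> he x x0.
  have [h1 h2] : normc h <= 1 /\ normc h <= ga / 4.
    by move: he; rewrite lt_min => /andP[? ?]; split; exact: ltW.
  have rh : - (ga / 4) <= Re h.
    by have := le_trans (le_Re_normc h) h2; rewrite ler_norml => /andP[].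
  have dc : d <= c1 by rewrite /d /c1; lra.
  have dck : d <= c1 + 2 * Re (k0 + h) by rewrite creim /d /c1; lra.
  have cc : c1 - 1 < c1 by lra.
  have z0 (t : R) : 0 <= t -> normsq (0 : C) <= 0 * expR (2 * (c1 - 1) * t).
    by move=> _; rewrite /normsq /= expr0n/= addr0 mul0r.
  apply: le_trans (hB _ _ _ _ c1 (c1 - 1) 0 (ps (k0 + h)) dc dck cc (lexx 0) z0 x x0) _.
  apply: ler_wpM2r; first exact: expR_ge0.
  apply: ler_wpM2l => //; rewrite mul0r addr0 phi0 u0 /S lerD2l -sqr_normc.
  rewrite ler_pXn2r ?nnegrE ?normc_ge0 ?addr_ge0 ?normc_ge0//.
  have -> : be + (k0 + h) * al = (be + k0 * al) + h * al by ring.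
  apply: le_trans (le_normcD _ _) _; rewrite lerD2l Normc.normcM.
  by rewrite ler_piMl ?normc_ge0.
pose M2 := B * (normsq al + 4 * M1 / ga).
have M20 : 0 <= M2.
  by rewrite mulr_ge0// addr_ge0 ?normsq_ge0// divr_ge0 ?(ltW ga0)// mulr_ge0.
have dc2 : d <= c2 by rewrite /d /c2; lra.
have dc2k : d <= c2 + 2 * Re k0 by rewrite /d /c2; lra.
have c12 : c1 < c2 by rewrite /c1 /c2; lra.
have c12E : c2 - c1 = ga by rewrite /c1 /c2; ring.
have dc3 : d <= c3 by rewrite /d /c3; lra.
have dc3k : d <= c3 + 2 * Re k0 by rewrite /d /c3; lra.
have c23 : c2 < c3 by rewrite /c2 /c3; lra.
have c23E : c3 - c2 = ga by rewrite /c2 /c3; ring.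
have step2 h : normc h < e ->
   phase_system V k0 (fun t => phi (k0 + h) t - phi k0 t)
     (fun t => u (k0 + h) t - u k0 t) (fun t => - (2 * h) * phi (k0 + h) t) /\
   forall x, 0 <= x -> normsq (phi (k0 + h) x - phi k0 x) <=
     (normc h ^+ 2 * M2) * expR (2 * c2 * x).
  move=> he.
  have pd : phase_system V k0 (fun t => phi (k0 + h) t - phi k0 t)
     (fun t => u (k0 + h) t - u k0 t) (fun t => - (2 * h) * phi (k0 + h) t).
    split.
      by apply: cprimitive_eq (cprimitiveB (ps (k0 + h)).1 (ps k0).1) => t //=; ring.
    by apply: cprimitive_eq (cprimitiveB (ps (k0 + h)).2 (ps k0).2) => t //=; ring.
  split=> // x x0.
  have M0 : 0 <= 4 * normc h ^+ 2 * M1 by rewrite !mulr_ge0 ?normc_ge0.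
  have gM t : 0 <= t -> normsq (- (2 * h) * phi (k0 + h) t) <=
      4 * normc h ^+ 2 * M1 * expR (2 * c1 * t).
    by move=> t0; apply: nsZ; exact: step1.
  apply: (le_trans (hB _ _ _ _ _ _ _ pd dc2 dc2k c12 M0 gM x x0)).
  apply: ler_wpM2r; first exact: expR_ge0.
  rewrite !phi0 !u0 subrr c12E.
  have -> : be + (k0 + h) * al - (be + k0 * al) = h * al by ring.
  rewrite normsqM -(sqr_normc h).
  have -> : normsq 0 = 0 :> R by rewrite /normsq /= expr0n/= addr0.
  by rewrite le_eqVlt; apply/orP; left; apply/eqP; rewrite /M2; ring.
have [pd [ud [psd pd0 ud0]]] := phase_system_inhomogeneous al s1 a1 b1 s2 a2 b2
  (cprimitiveZ (- (2 * 1)) (ps k0).1).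
have pd_le x : 0 <= x -> normsq (pd x) <= M2 * expR (2 * c2 * x).
  move=> x0.
  have M0 : 0 <= 4 * normc 1 ^+ 2 * M1 by rewrite !mulr_ge0 ?normc_ge0.
  have gM t : 0 <= t -> normsq (- (2 * 1) * phi k0 t) <=
      4 * normc 1 ^+ 2 * M1 * expR (2 * c1 * t).
    move=> t0; apply: nsZ; rewrite -[k0]addr0; apply: step1 => //.
    by rewrite Normc.normc0.
  apply: (le_trans (hB _ _ _ _ _ _ _ psd dc2 dc2k c12 M0 gM x x0)).
  apply: ler_wpM2r; first exact: expR_ge0.
  rewrite pd0 ud0 Normc.normc1 c12E.
  have -> : normsq 0 = 0 :> R by rewrite /normsq /= expr0n/= addr0.
  by rewrite le_eqVlt; apply/orP; left; apply/eqP; rewrite /M2; ring.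
pose M3 := B * (4 * M2 / ga).
have M30 : 0 <= M3 by rewrite mulr_ge0// divr_ge0 ?(ltW ga0)// mulr_ge0.
have step3 h : normc h < e ->
   cmeasurable (fun t => phi (k0 + h) t - phi k0 t - h * pd t) /\
   forall x, 0 <= x ->
   normsq (phi (k0 + h) x - phi k0 x - h * pd x) <=
     (normc h ^+ 4 * M3) * expR (2 * c3 * x).
  move=> he; have [psh hle] := step2 h he.
  have pr : phase_system V k0 (fun t => phi (k0 + h) t - phi k0 t - h * pd t)
     (fun t => u (k0 + h) t - u k0 t - h * ud t)
     (fun t => - (2 * h) * (phi (k0 + h) t - phi k0 t)).
    split.
      by apply: cprimitive_eq (cprimitiveB psh.1 (cprimitiveZ h psd.1)) => t //=; ring.
    by apply: cprimitive_eq (cprimitiveB psh.2 (cprimitiveZ h psd.2)) => t //=; ring.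
  split; first exact: cmeasurable_cprimitive pr.1.
  move=> x x0.
  have M0 : 0 <= 4 * normc h ^+ 2 * (normc h ^+ 2 * M2).
    by rewrite mulr_ge0// mulr_ge0// sqr_ge0.
  have gM t : 0 <= t -> normsq (- (2 * h) * (phi (k0 + h) t - phi k0 t)) <=
      4 * normc h ^+ 2 * (normc h ^+ 2 * M2) * expR (2 * c2 * t).
    by move=> t0; apply: nsZ; exact: hle.
  apply: (le_trans (hB _ _ _ _ _ _ _ pr dc3 dc3k c23 M0 gM x x0)).
  apply: ler_wpM2r; first exact: expR_ge0.
  rewrite !phi0 !u0 pd0 ud0 c23E.
  have -> : al - al - h * 0 = 0 by ring.
  have -> : be + (k0 + h) * al - (be + k0 * al) - h * al = 0 by ring.
  have -> : normsq 0 = 0 :> R by rewrite /normsq /= expr0n/= addr0.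
  by rewrite le_eqVlt; apply/orP; left; apply/eqP; rewrite /M3; ring.
have root (y : C) (M c x : R) : 0 <= M -> normsq y <= M * expR (2 * c * x) ->
    normc y <= Num.sqrt M * expR (c * x).
  move=> M0 h; rewrite -(ler_pXn2r (n := 2)) ?nnegrE ?normc_ge0 ?mulr_ge0 ?sqrtr_ge0 ?expR_ge0//.
  rewrite sqr_normc exprMn sqr_sqrtr// [expR _ ^+ 2]expr2 -expRD.
  by have -> : c * x + c * x = 2 * c * x by ring.
have mpd := cmeasurable_cprimitive psd.1.
have [ipd _] := tail_integral dV c2a mpd (fun x x0 => root _ _ _ _ M20 (pd_le x x0)).
have rayM := measurable_itv `[(0 : R), +oo[.
exists (al + cintegral `[0, +oo[ (fun y => V y * pd y)).
exists (2 * Num.sqrt M3 * tail_mass V c3), e => // h he.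
have [mr rle] := step3 h he.
have kah : - a < Re (k0 + h).
  have h2 : normc h < ga / 4 by move: he; rewrite lt_min => /andP[].
  have rh : - (ga / 4) < Re h.
    by have := le_lt_trans (le_Re_normc h) h2; rewrite ltr_norml => /andP[].
  by rewrite creim; move: rh; rewrite /ga; lra.
have i1 := tail_solution a0 dV kah (sol (k0 + h)).
have i2 := tail_solution a0 dV ka (sol k0).
have M3h : 0 <= normc h ^+ 4 * M3 by rewrite mulr_ge0// exprn_ge0// normc_ge0.
have [_ rint] := tail_integral dV c3a mr (fun x x0 => root _ _ _ _ M3h (rle x x0)).
have sq : Num.sqrt (normc h ^+ 4 * M3) = normc h ^+ 2 * Num.sqrt M3.
  rewrite sqrtrM ?exprn_ge0 ?normc_ge0//.
  have -> : normc h ^+ 4 = (normc h ^+ 2) ^+ 2 by rewrite -exprM.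
  by rewrite sqrtr_sqr ger0_norm ?sqr_ge0.
rewrite sq in rint.
have [j2 e2] := cintegrableZ (- 1) rayM i2.
have [j3 e3] := cintegrableZ (- h) rayM ipd.
have [j12 e12] := cintegrableD rayM i1 j2.
have [j123 e123] := cintegrableD rayM j12 j3.
apply: le_trans (_ : 2 * (normc h ^+ 2 * Num.sqrt M3) * tail_mass V c3 <= _); last first.
  by rewrite le_eqVlt; apply/orP; left; apply/eqP; ring.
apply: le_trans rint; rewrite le_eqVlt; apply/orP; left; apply/eqP; congr normc.
transitivity (cintegral `[0, +oo[ (fun t => V t * phi (k0 + h) t + - 1 * (V t * phi k0 t)
   + - h * (V t * pd t))).
  rewrite e123 e12 e2 e3 /plus_coef (ini (k0 + h)).1 (ini (k0 + h)).2.
  by rewrite (ini k0).1 (ini k0).2 /phi; ring.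
by congr cintegral; apply/funext => t; ring.
Qed.

End holomorphy.

(** * Complex differentiability of the determinant *)

Section derivable.
Context {K : numFieldType}.
Implicit Types (f g : K -> K) (s h L B e c : K).

Lemma derivable_of_quadratic f s L B e :
  0 < e -> 0 <= B ->
  (forall h, `|h| < e -> `|f (s + h) - f s - h * L| <= B * `|h| ^+ 2) ->
  derivable f s 1.
Proof.
move=> e0 B0 hf; apply/cvg_ex; exists L.
apply/cvgrPdist_le => ep ep0.
near=> h.
have he : `|h| < e by near: h; exact: dnbhs0_lt.
have hep : `|h| < ep / (B + 1).
  by near: h; apply: dnbhs0_lt; rewrite divr_gt0// ltr_wpDl.
have h0 : h != 0 by near: h; exact: nbhs_dnbhs_neq.
have nh0 : 0 < `|h| by rewrite normr_gt0.
have -> : L - h^-1 *: (f (h *: 1 + s) - f s) = - h^-1 * (f (s + h) - f s - h * L).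
  have -> : h *: 1 + s = s + h by rewrite addrC -[h *: 1]/(h * 1) mulr1.
  by rewrite -[h^-1 *: _]/(h^-1 * _); field.
rewrite normrM normrN normfV mulrC ler_pdivrMr//.
apply: le_trans (hf h he) _.
rewrite expr2 mulrA ler_wpM2r//.
rewrite ltr_pdivlMr ?ltr_wpDl// in hep; apply: le_trans (ltW hep).
by rewrite mulrC ler_wpM2l// lerDl.
Unshelve. all: by end_near. Qed.


Lemma derivable_near_eq f g s e : 0 < e ->
  (forall h, `|h| < e -> f (s + h) = g (s + h)) ->
  derivable f s 1 -> derivable g s 1.
Proof.
move=> e0 fg; apply: near_eq_derivable.
near=> y; rewrite -[y](subrK s) addrC; apply: fg.
rewrite distrC; near: y; exact: (@nbhsx_ballx _ _ s e).
Unshelve. all: by end_near. Qed.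

Lemma derivable_det (p1 p2 q1 q2 : K -> K) s c : c != 0 -> s != 0 ->
  derivable p1 s 1 -> derivable p2 s 1 -> derivable q1 s 1 -> derivable q2 s 1 ->
  derivable (fun s => (c * s)^-1 * (q1 s * p2 s - p1 s * q2 s)) s 1.
Proof.
move=> c0 s0 dp1 dp2 dq1 dq2.
apply: derivableM; last by apply: derivableB; exact: derivableM.
apply: derivableV; first by rewrite mulf_neq0.
by apply: derivableM; [exact: derivable_cst|exact: derivable_id].
Qed.

End derivable.

Section coefficients.
Context {R : realType}.
Local Notation C := R[i].
Local Notation Re := (@complex.Re R).
Local Notation Im := (@complex.Im R).
Local Notation normc := (@Normc.normc R).
Implicit Types (V mu f : R -> C) (k l z s h : C).

Lemma sqrtND s h : sqrtN (s + h) = sqrtN s + 'i * h.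
Proof. by rewrite /sqrtN mulrDr. Qed.

Lemma norm_i_mul h : normc ('i * h) = normc h.
Proof.
rewrite Normc.normcM normcE /normsq /= expr0n/= add0r expr1n sqrtr1.
by rewrite mul1r.
Qed.

Lemma plus_coef_derivable a V (nu nu' : C -> R -> C) nu1 nu1' nu2 nu2' (al be s : C) :
  0 < a -> exp_decay a V -> Im s < a ->
  (forall l, solution_pair V l (nu l) (nu' l)) ->
  (forall l, nu l 0 = al /\ nu' l 0 = be) ->
  solution_pair V (lam s) nu1 nu1' -> nu1 0 = 1 -> nu1' 0 = 0 ->
  solution_pair V (lam s) nu2 nu2' -> nu2 0 = 0 -> nu2' 0 = 1 ->
  holomorphic_on [set s] (fun s => plus_coef V (sqrtN s) (nu (lam s)) (nu' (lam s))).
Proof.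
move=> a0 dV sa sol ini; rewrite lamE => s1 a1 b1 s2 a2 b2 _ ->.
have ka : - a < Re (sqrtN s) by rewrite Re_sqrtN ltrN2.
have [L [B [e e0 hq]]] := plus_coef_holomorphic a0 dV ka
  (fun k => sol (- k ^+ 2)) (fun k => ini (- k ^+ 2)) s1 a1 b1 s2 a2 b2.
apply: (@derivable_of_quadratic _ _ s ('i * L) `|B|%:C e%:C).
- by rewrite ltcR.
- by rewrite lecR.
move=> h; rewrite complex_normE ltcR => he.
have := hq ('i * h); rewrite norm_i_mul => /(_ he); rewrite -!sqrtND -!lamE => H.
rewrite -rmorphXn/= -rmorphM/= complex_normE lecR.
have -> : h * ('i * L) = 'i * h * L by ring.
apply: (le_trans H); apply: ler_wpM2r; first exact: sqr_ge0.
exact: ler_norm.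
Qed.

Lemma minus_coef_derivable a V (nu nu' : C -> R -> C) nu1 nu1' nu2 nu2' (al be s : C) :
  0 < a -> exp_decay a V -> Im s < a ->
  (forall l, solution_pair V l (nu l) (nu' l)) ->
  (forall l, nu l 0 = al /\ nu' l 0 = be) ->
  solution_pair V (lam s) nu1 nu1' -> nu1 0 = 1 -> nu1' 0 = 0 ->
  solution_pair V (lam s) nu2 nu2' -> nu2 0 = 0 -> nu2' 0 = 1 ->
  holomorphic_on [set s] (fun s => minus_coef V (sqrtN s) (nu (lam s)) (nu' (lam s))).
Proof.
move=> a0 dV sa sol ini s1 a1 b1 s2 a2 b2.
have t1 := solution_pair_opp s1; have t2 := solution_pair_opp s2.
have t2' := solution_pair_comb 0 (-1) t1 t2.
apply: (@plus_coef_derivable a _ (fun l t => nu l (- t)) (fun l t => - nu' l (- t))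
  _ _ _ _ al (- be) s a0 (exp_decay_opp dV) sa _ _ t1 _ _ t2').
- by move=> l; exact: solution_pair_opp.
- by move=> l; rewrite oppr0 (ini l).1 (ini l).2.
- by rewrite oppr0.
- by rewrite oppr0 b1 oppr0.
- by rewrite oppr0 a2; ring.
- by rewrite oppr0 b2; ring.
Qed.

End coefficients.

Theorem theorem4p1 (R : realType) (a : R) (V : R -> R[i])
    (nu1 nu2 : R[i] -> R -> R[i])
    (a_gt0 : 0 < a)
    (V_L2 : in_L2 (fun=> 1) (fun x => (expR (2 * a * `|x|))%:C * V x))
    (nu1_sol : forall l : R[i], is_solution V l (nu1 l))
    (nu1_0 : forall l : R[i], nu1 l 0 = 1 /\ cderiv (nu1 l) 0 = 0)
    (nu2_sol : forall l : R[i], is_solution V l (nu2 l))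
    (nu2_0 : forall l : R[i], nu2 l 0 = 0 /\ cderiv (nu2 l) 0 = 1) :
  [/\ forall x : R,
        holomorphic_on (P a) (fun s => DD V s (nu1 (lam s)) (nu2 (lam s)) x),
      forall (s : R[i]) (x : R), P a s ->
        (DD V s (nu1 (lam s)) (nu2 (lam s)) x = 0 <->
         generalized_eigenvalue V a s) &
      forall (s : R[i]) (mup mum : R -> R[i]) (x y : R), first_sheet s ->
        is_mu_plus V s mup -> is_mu_minus V s mum ->
        DD V s (nu1 (lam s)) (nu2 (lam s)) x =
        (2 * sqrtN s)^-1 * evans mup mum y].
Proof.
have dV := exp_decay_of_L2 a_gt0 V_L2.
have sol1 l := is_solution_pair (nu1_sol l).
have sol2 l := is_solution_pair (nu2_sol l).
have [a1 b1] : (forall l, nu1 l 0 = 1) /\ (forall l, cderiv (nu1 l) 0 = 0).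
  by split=> l; have [] := nu1_0 l.
have [a2 b2] : (forall l, nu2 l 0 = 0) /\ (forall l, cderiv (nu2 l) 0 = 1).
  by split=> l; have [] := nu2_0 l.
split.
- move=> x s [s0 /andP[_ sa]].
  pose e := Num.min (Normc.normc s) (a - complex.Im s).
  have e0 : 0 < e.
    rewrite lt_min subr_gt0 sa andbT lt_neqAle normc_ge0 andbT eq_sym.
    by apply/negP => /eqP /Normc.eq0_normc /eqP; rewrite (negbTE s0).
  have i0 : 2 * 'i != 0 :> R[i].
    have := @sqrtN_neq0 R 1 (oner_neq0 _); rewrite /sqrtN mulr1 => ?.
    by rewrite mulf_neq0// pnatr_eq0.
  have dp1 := plus_coef_derivable a_gt0 dV sa sol1 nu1_0 (sol1 _) (a1 _) (b1 _)
    (sol2 _) (a2 _) (b2 _) (erefl s).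
  have dp2 := plus_coef_derivable a_gt0 dV sa sol2 nu2_0 (sol1 _) (a1 _) (b1 _)
    (sol2 _) (a2 _) (b2 _) (erefl s).
  have dq1 := minus_coef_derivable a_gt0 dV sa sol1 nu1_0 (sol1 _) (a1 _) (b1 _)
    (sol2 _) (a2 _) (b2 _) (erefl s).
  have dq2 := minus_coef_derivable a_gt0 dV sa sol2 nu2_0 (sol1 _) (a1 _) (b1 _)
    (sol2 _) (a2 _) (b2 _) (erefl s).
  apply: derivable_near_eq (derivable_det i0 s0 dp1 dp2 dq1 dq2).
    by move: e0; rewrite -ltcR; apply.
  move=> h; rewrite complex_normE ltcR lt_min => /andP[hs ha].
  have sh0 : s + h != 0.
    apply/negP => /eqP sh; have : s = - h by apply/eqP; rewrite -addr_eq0 sh.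
    by move=> sE; move: hs; rewrite sE normcN ltxx.
  have sha : complex.Im (s + h) < a.
    have := le_lt_trans (le_Im_normc h) ha; rewrite ltr_norml => /andP[_].
    by rewrite cImD; lra.
  by rewrite (DD_solution x a_gt0 dV sh0 sha (sol1 _) (sol2 _)) /sqrtN mulrA.
- move=> s x Ps; split.
    exact: eigenvalue_of_DD0 a_gt0 dV Ps (sol1 _) (a1 _) (b1 _) (sol2 _) (a2 _) (b2 _).
  exact: DD0_of_eigenvalue a_gt0 V_L2 Ps (sol1 _) (a1 _) (b1 _) (sol2 _) (a2 _) (b2 _).
move=> s mup mum x y s_first [/is_solution_pair solp limp limp'].
move=> [/is_solution_pair solm limm limm'].
have sim : complex.Im s < 0 := s_first.
have s0 : s != 0 by apply/negP => /eqP sE; move: sim; rewrite sE ltxx.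
have sa : complex.Im s < a := lt_trans sim a_gt0.
have rk : 0 < complex.Re (sqrtN s) by rewrite Re_sqrtN oppr_gt0.
rewrite (DD_solution x a_gt0 dV s0 sa (sol1 _) (sol2 _)); congr (_ * _).
rewrite /evans (wronskian_cst solp solm y 0).
have s1 := sol1 (lam s); have s2 := sol2 (lam s).
have t1 := solution_pair_opp s1; have t2 := solution_pair_opp s2.
have tm := solution_pair_opp solm.
rewrite lamE in solp s1 s2 t1 t2 tm.
have limN : ((fun x => mum (- x)) x * cexp (sqrtN s * x%:C)) @[x --> +oo] --> (1 : R[i]^o).
  have := (@cvgNy_compNP R[i]^o R _ _).1 limm; apply: cvg_trans; apply: near_eq_cvg; apply: nearW => t /=.
  by congr (_ * cexp _); apply: complex_eq; rewrite !creim; ring.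
have limN' : ((fun x => - cderiv mum (- x)) x * cexp (sqrtN s * x%:C)) @[x --> +oo]
    --> (- sqrtN s : R[i]^o).
  have H : (cderiv mum (- x) * cexp (sqrtN s * x%:C)) @[x --> +oo] --> (sqrtN s : R[i]^o).
    have := (@cvgNy_compNP R[i]^o R _ _).1 limm'; apply: cvg_trans.
    apply: near_eq_cvg; apply: nearW => t /=.
    by congr (_ * cexp _); apply: complex_eq; rewrite !creim; ring.
  have E : (fun x => - cderiv mum (- x) * cexp (sqrtN s * x%:C)) =
    - (fun x => cderiv mum (- x) * cexp (sqrtN s * x%:C)).
    by apply/funext => t; rewrite mulNr.
  by rewrite /= E; exact: (@cvgN R[i] R[i]^o _ _ _ _ _ H).
have dV' := exp_decay_opp dV.
rewrite lamE /minus_coef.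
rewrite (jost_plus_coef a_gt0 dV rk solp s1 limp limp').
rewrite (jost_plus_coef a_gt0 dV rk solp s2 limp limp').
rewrite (jost_plus_coef a_gt0 dV' rk tm t1 limN limN').
rewrite (jost_plus_coef a_gt0 dV' rk tm t2 limN limN').
by rewrite oppr0 a1 a2 b1 b2; ring.
Qed.
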